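(* Let $w$ be an even positive integer, and let $m$ and $n$ be positive integers with $0<n<w$. The actions of the Hecke operators $T_m$ on the cusp form $R_{w,n}$, the Dedekind symbol $E_{w,n}$ and the polynomial $S_{w,n}$ are expressed as follows: $$T_m(R_{w,n})=R_{w,n}^m,\qquad T_m(E_{w,n})=E_{w,n}^m,\qquad T_m(S_{w,n})=S_{w,n}^m .$$
   Context: Notation. $\tilde n=w-n$; $\Gamma=SL_2(\mathbb Z)$; $S_{w+2}$ is the space of cusp forms of weight $w+2$ on $\Gamma$; $H_m$ is the set of integer matrices $\left[\begin{smallmatrix}a&b\\c&d\end{smallmatrix}\right]$ with $ad-bc=m$; $\sigma_k(m)=\sum_{a\mid m,\,a>0}a^k$; $\mathrm{sgn}$ is the sign function; $\mathbb Z^+$ is the set of positive integers; $B_j(x)$ is the $j$th Bernoulli polynomial ($\frac{te^{xt}}{e^t-1}=\sum_{j\ge0} B_j(x)\frac{t^j}{j!}$), $B_j=B_j(0)$, and $\bar B_j(x)$ is the function of period $1$ coinciding with $B_j(x)$ on $[0,1)$. The functions. Put $c_{w,n}=(-1)^{n+1}2\pi i\binom wn$, and let $\kappa_n=\frac{w+2}{B_{w+2}}\frac{B_{n+1}}{n+1}\frac{B_{\tilde n+1}}{\tilde n+1}$ if $n$ is odd, $\kappa_n=0$ if $n$ is even. For every $m\ge1$: $$R^m_{w,n}(z)=m^{w+1}c_{w,n}^{-1}\sum_{\left[\begin{smallmatrix}a&b\\c&d\end{smallmatrix}\right]\in H_m}\frac1{(az+b)^{n+1}(cz+d)^{\tilde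 n+1}}\qquad(\mathrm{Im}\,z>0);$$ for $(h,k)\in\mathbb Z^+\times\mathbb Z$, $$E^m_{w,n}(h,k)=\frac12\sum_{\substack{\left[\begin{smallmatrix}a&b\\c&d\end{smallmatrix}\right]\in H_m\\ ac\ne0\\ (k/h+b/a)(k/h+d/c)<0}}\mathrm{sgn}\Big(\frac kh+\frac ba\Big)(ak+bh)^{\tilde n}(ck+dh)^n+\sum_{\substack{ad=m\\ a>0}}\Big\{(-1)^nd^{\tilde n}\frac{\bar B_{n+1}(\frac{ak}h)h^w}{n+1}-d^n\frac{\bar B_{\tilde n+1}(\frac{ak}h)h^w}{\tilde n+1}\Big\}+\sigma_{w+1}(m)\kappa_nh^w$$ (a finite sum); and the polynomial in $h,k$ $$\begin{aligned}S^m_{w,n}(h,k)=&\ \frac12\sum_{\substack{\left[\begin{smallmatrix}a&b\\c&d\end{smallmatrix}\right]\in H_m\\ abcd<0}}\mathrm{sgn}(ab)(ak+bh)^{\tilde n}(ck+dh)^n+\sum_{\substack{ad=m\\ a>0}}d^{\tilde n}\Big\{(-1)^n\frac{B_{n+1}(\frac{ak}h)h^w}{n+1}+\frac{B_{n+1}(\frac{ah}k)k^w}{n+1}\Big\}\\&-\sum_{\substack{ad=m\\ a>0}}d^n\Big\{\frac{B_{\tilde n+1}(\frac{ak}h)h^w}{\tilde n+1}+(-1)^n\frac{B_{\tilde n+1}(\frac{ah}k)k^w}{\tilde n+1}\Big\}+\sigma_{w+1}(m)\kappa_n(h^w-k^w).\end{aligned}$$ Set $R_{w,n}=R_{w,n}^1\in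 S_{w+2}$, $E_{w,n}=E^1_{w,n}$, $S_{w,n}=S^1_{w,n}$. Spaces. A Dedekind symbol of weight $w$ is a function $E:\mathbb Z^+\times\mathbb Z\to\mathbb C$ with $E(h,k)=E(h,k+h)$ and $E(ch,ck)=c^wE(h,k)$ for $c\in\mathbb Z^+$; it is even/odd if $E(h,-k)=\pm E(h,k)$. $\mathcal E_w^{\pm}$ is the space of even ($+$) / odd ($-$) Dedekind symbols $E$ of weight $w$ such that $\beta_w(E)(h,k):=E(h,k)-E(k,-h)$ (for $h,k\in\mathbb Z^+$) is a homogeneous polynomial of degree $w$. $\mathcal U_w^{\pm}$ is the space of homogeneous polynomials $g(h,k)$ of degree $w$ with $g(h+k,k)+g(h,h+k)=g(h,k)$, $g(1,1)=0$ and $g(h,-k)=\pm g(h,k)$. It is known that $\beta_w$ maps $\mathcal E_w^\pm$ onto $\mathcal U_w^\pm$, with kernel contained in $\mathbb C\,G_w$, $G_w(h,k)=\gcd(h,k)^w$. It is also known that $E_{w,n}\in\mathcal E_w^+$, $S_{w,n}\in\mathcal U_w^+$ for $n$ odd and $E_{w,n}\in\mathcal E_w^-$, $S_{w,n}\in\mathcal U_w^-$ for $n$ even, and $\beta_w(E_{w,n})=S_{w,n}$. Hecke operators. On $S_{w+2}$: $(T_mf)(z)=m^{w+1}\sum_{ad=m,\,a>0}\ \sum_{b\bmod d}d^{-w-2}f\big(\frac{az+b}d\big)$. On Dedekind symbols: $(T_mE)(h,k)=\sum_{ad=m,\,d>0}\ \sum_{b\bmod d}E(dh,ak+bh)$.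 On $\mathcal U_w^\pm$: $T_m$ is the Hecke operator on period polynomials (Manin, Zagier), which is compatible with the two operators above under the maps $f\mapsto E_f^\pm$ and $\beta_w$, where $E_f(h,k)=\int_{k/h}^{i\infty}f(z)(hz-k)^wdz$ and $E_f^\pm(h,k)=\frac12\{E_f(h,k)\pm E_f(h,-k)\}$; that is, $T_m(E_f^\pm)=E_{T_mf}^\pm$ and $T_m(\beta_w(E_f^\pm))=\beta_w(E_{T_mf}^\pm)$ for $f\in S_{w+2}$. The polynomial $S_{w,n}$ is known to lie in the image of $f\mapsto\beta_w(E_f^{\pm})$ ($+$ for $n$ odd, $-$ for $n$ even), so $T_m(S_{w,n})$ is determined by this; equivalently, $T_m(S_{w,n})=\beta_w(T_mE)$ for any $E\in\mathcal E_w^\pm$ with $\beta_w(E)=S_{w,n}$. *)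

(* Defs.v *)
From HB Require Import structures.
From mathcomp Require Import all_boot all_order all_algebra.
From mathcomp Require Import finmap complex.
(* The notations of [mpoly] do not parse together with those of analysis. *)
From mathcomp Require Import -(notations) mpoly.
From mathcomp Require summability.
From mathcomp Require Import all_classical all_reals all_analysis.

Set Implicit Arguments.
Unset Strict Implicit.
Unset Printing Implicit Defensive.

Import Order.TTheory GRing.Theory Num.Theory.
Import numFieldNormedType.Exports.

Local Open Scope classical_set_scope.
Local Open Scope ring_scope.

(* Bernoulli polynomials: [bernoulli_seq n] lists B_0, ..., B_(n-1). *)
Fixpoint bernoulli_seq (n : nat) : seq {poly rat} :=
  if n is p.+1 then
    rcons (bernoulli_seq p)
      ('X^p - p.+1%:R^-1 *:
                \sum_(i < p) 'C(p.+1, i)%:R *: (bernoulli_seq p)`_i)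
  else [::].

Definition bernoulli_poly (j : nat) : {poly rat} := (bernoulli_seq j.+1)`_j.

Definition bernoulli (j : nat) : rat := (bernoulli_poly j).[0].

Definition bernoulli_periodic (j : nat) (x : rat) : rat :=
  (bernoulli_poly j).[x - (Num.floor x)%:~R].

Lemma size_bernoulli_seq n : size (bernoulli_seq n) = n.
Proof. by elim: n => //= n IHn; rewrite size_rcons IHn. Qed.

Lemma nth_bernoulli_seq n i :
  (i < n)%N -> (bernoulli_seq n)`_i = bernoulli_poly i.
Proof.
elim: n => // n IHn; rewrite ltnS leq_eqVlt => /orP[/eqP->//|lt_in].
by rewrite /= nth_rcons size_bernoulli_seq lt_in IHn.
Qed.

Lemma bernoulli_polyE j :
  bernoulli_poly j =
  'X^j - j.+1%:R^-1 *: \sum_(i < j) 'C(j.+1, i)%:R *: bernoulli_poly i.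
Proof.
rewrite {1}/bernoulli_poly /= nth_rcons size_bernoulli_seq ltnn eqxx.
congr (_ - _ *: _); apply: eq_bigr => i _.
by rewrite nth_bernoulli_seq.
Qed.

(* Comparison of the coefficients of t^n in
   (e^t - 1) * (\sum_j B_j(x) t^j / j!) = t * e^(x t). *)
Lemma bernoulli_poly_gen n :
  \sum_(j < n) ((n - j)`!%:R^-1 * j`!%:R^-1) *: bernoulli_poly j =
  if n is p.+1 then p`!%:R^-1 *: 'X^p else 0.
Proof.
case: n => [|p]; first by rewrite big_ord0.
have fact_neq0 k : k`!%:R != 0 :> rat by rewrite pnatr_eq0 -lt0n fact_gt0.
have p1_neq0 : p.+1%:R != 0 :> rat by rewrite pnatr_eq0.
rewrite big_ord_recr /= subSnn (_ : 1`! = 1%N) // invr1 mul1r.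
rewrite [bernoulli_poly p]bernoulli_polyE scalerBr addrCA scalerA.
rewrite -[RHS]addr0; congr (_ + _); apply/eqP; rewrite subr_eq0; apply/eqP.
rewrite scaler_sumr; apply: eq_bigr => i _; rewrite scalerA.
congr (_ *: _).
have le_ip : (i <= p.+1)%N by rewrite ltnW // ltnS ltnW.
have := congr1 (fun k => k%:R : rat) (bin_fact le_ip).
rewrite factS !natrM => bin_eq.
have -> : 'C(p.+1, i)%:R = p.+1%:R * p`!%:R / (i`!%:R * (p.+1 - i)`!%:R) :> rat.
  by rewrite -bin_eq mulfK // mulf_neq0.
by rewrite -[p`!%:R^-1 / _]invfM [p`!%:R * _]mulrC mulKf ?mulf_neq0 // invfM mulrC.
Qed.

Definition inH (m : nat) (A : 'M[int]_2) : bool := \det A == m%:Z.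

Definition sigma (k m : nat) : nat := (\sum_(a <- divisors m) a ^ k)%N.

Definition kappa (w n : nat) : rat :=
  if odd n then
    (w + 2)%:R / bernoulli (w + 2) * (bernoulli n.+1 / n.+1%:R)
      * (bernoulli (w - n).+1 / (w - n).+1%:R)
  else 0.

Section HeckeActions.
Variable R : realType.
Local Notation C := R[i].

Definition c_ (w n : nat) : C :=
  (-1) ^+ n.+1 * 2 * (pi : R)%:C%C * 'i%C * 'C(w, n)%:R.

(* The sum is unordered: limit of the partial sums over the finite subsets of
   H_m. [C^o] is C as a normed module over itself. *)
Definition Rm (w n m : nat) (z : C) : C :=
  m%:R ^+ w.+1 * (c_ w n)^-1 *
  summability.sum (fun A : {A : 'M[int]_2 | inH m A} =>
    let a := val A 0 0 in let b := val A 0 1 in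
    let c := val A 1 0 in let d := val A 1 1 in
    1 / ((a%:~R * z + b%:~R) ^+ n.+1 * (c%:~R * z + d%:~R) ^+ (w - n).+1)
    : C^o).

Definition Em_index (m : nat) (h k : int) : set 'M[int]_2 :=
  [set A : 'M[int]_2 | let a := A 0 0 in let b := A 0 1 in
     let c := A 1 0 in let d := A 1 1 in
     [/\ inH m A, a * c != 0 &
       (k%:Q / h%:Q + b%:Q / a%:Q) * (k%:Q / h%:Q + d%:Q / c%:Q) < 0]].

(* Only the values at 0 < h are meaningful. All values are rational. *)
Definition Em (w n m : nat) (h k : int) : C :=
  ratr (2^-1 * (\sum_(A \in Em_index m h k)
            let a := A 0 0 in let b := A 0 1 in
            let c := A 1 0 in let d := A 1 1 in
            Num.sg (k%:Q / h%:Q + b%:Q / a%:Q)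
              * (a * k + b * h)%:Q ^+ (w - n) * (c * k + d * h)%:Q ^+ n)
    + \sum_(a <- divisors m)
        (let d := (m %/ a)%N in
         (-1) ^+ n * d%:R ^+ (w - n)
           * (bernoulli_periodic n.+1 (a%:Q * k%:Q / h%:Q) * h%:Q ^+ w
                / n.+1%:R)
         - d%:R ^+ n
           * (bernoulli_periodic (w - n).+1 (a%:Q * k%:Q / h%:Q) * h%:Q ^+ w
                / (w - n).+1%:R))
    + (sigma w.+1 m)%:R * kappa w n * h%:Q ^+ w).

Definition var_h : mpoly 2 C := mpolyX C (mnm1 (0 : 'I_2)).
Definition var_k : mpoly 2 C := mpolyX C (mnm1 (1 : 'I_2)).

Definition eval2 (g : mpoly 2 C) (h k : C) : C :=
  meval (fun i : 'I_2 => if i == 0 then h else k) g.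

Definition homogeneous (w : nat) (g : mpoly 2 C) : bool :=
  g \is @ishomog1 2 C w (@mdeg 2).

(* The polynomial B_j(a y / x) x^w, for j <= w. *)
Definition bernoulli_hom (w j a : nat) (x y : mpoly 2 C) : mpoly 2 C :=
  \sum_(i < j.+1)
    (ratr (bernoulli_poly j)`_i : C) *: ((a%:R * y) ^+ i * x ^+ (w - i)).

Definition Sm_index (m : nat) : set 'M[int]_2 :=
  [set A : 'M[int]_2 | inH m A /\ A 0 0 * A 0 1 * A 1 0 * A 1 1 < 0].

Definition Sm (w n m : nat) : mpoly 2 C :=
  2^-1 *: (\sum_(A \in Sm_index m)
     let a := A 0 0 in let b := A 0 1 in
     let c := A 1 0 in let d := A 1 1 in
     (Num.sg (a * b))%:~R * (a%:~R * var_k + b%:~R * var_h) ^+ (w - n)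
       * (c%:~R * var_k + d%:~R * var_h) ^+ n)
  + \sum_(a <- divisors m)
      (let d := (m %/ a)%N in
       (d%:R ^+ (w - n) / n.+1%:R) *:
         ((-1) ^+ n * bernoulli_hom w n.+1 a var_h var_k
          + bernoulli_hom w n.+1 a var_k var_h))
  - \sum_(a <- divisors m)
      (let d := (m %/ a)%N in
       (d%:R ^+ n / (w - n).+1%:R) *:
         (bernoulli_hom w (w - n).+1 a var_h var_k
          + (-1) ^+ n * bernoulli_hom w (w - n).+1 a var_k var_h))
  + ((sigma w.+1 m)%:R * ratr (kappa w n)) *: (var_h ^+ w - var_k ^+ w).

(* A Dedekind symbol is a function of (h, k) with 0 < h; its values at h <= 0
   are irrelevant. *)
Definition dedekind_symbol (w : nat) (E : int -> int -> C) : Prop :=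
  (forall h k, 0 < h -> E h k = E h (k + h)) /\
  (forall c h k, 0 < c -> 0 < h -> E (c * h) (c * k) = c%:~R ^+ w * E h k).

(* beta_w(E) = g as homogeneous polynomials of degree w *)
Definition beta_eq (w : nat) (E : int -> int -> C) (g : mpoly 2 C) : Prop :=
  homogeneous w g /\
  (forall h k, 0 < h -> 0 < k ->
     E h k - E k (- h) = eval2 g h%:~R k%:~R).

(* [s = false] gives the space of even symbols, [s = true] that of odd ones. *)
Definition dedekind_space (w : nat) (s : bool) : set (int -> int -> C) :=
  [set E | [/\ dedekind_symbol w E,
               forall h k, 0 < h -> E h (- k) = (-1) ^+ s * E h k &
               exists g, beta_eq w E g]].

Definition hecke_form (w m : nat) (f : C -> C) (z : C) : C :=
  m%:R ^+ w.+1 * \sum_(d <- divisors m) \sum_(b < d)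
    d%:R ^- (w + 2) * f (((m %/ d)%N%:R * z + b%:R) / d%:R).

Definition hecke_dedekind (m : nat) (E : int -> int -> C) (h k : int) : C :=
  \sum_(d <- divisors m) \sum_(b < d)
    E (d%:Z * h) ((m %/ d)%N%:Z * k + b%:Z * h).

(* T_m(g) = g' for the Hecke operator on period polynomials, characterized by
   T_m(beta_w(E)) = beta_w(T_m(E)): g is some beta_w(E), with E even or odd
   according to s, and every such E satisfies beta_w(T_m(E)) = g'. The
   polynomial g' is determined by its values at positive integers. *)
Definition hecke_period_eq (w : nat) (s : bool) (m : nat) (g g' : mpoly 2 C) :
    Prop :=
  (exists2 E, dedekind_space w s E & beta_eq w E g) /\
  (forall E, dedekind_space w s E -> beta_eq w E g ->
     beta_eq w (hecke_dedekind m E) g').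

End HeckeActions.

(* Main.v *)
Require Import Defs.
From mathcomp Require Import all_boot all_order all_algebra complex reals.
From mathcomp Require Import -(notations) mpoly.
From mathcomp Require Import ring lra zify finmap.
From mathcomp Require summability.
From mathcomp Require Import all_classical all_analysis.
Set Implicit Arguments.
Unset Strict Implicit.
Unset Printing Implicit Defensive.
Import Order.TTheory GRing.Theory Num.Theory.
Import numFieldNormedType.Exports.
Local Open Scope ring_scope.

(** Left multiplication by $SL_2(Z)$ splits $H_m$ into orbits, and every orbit
    contains exactly one Hermite normal form $M = (a, b; 0, d)$ with $a d = m$
    and $0 \le b < d$ ([hermite_exists], [hermite_unique]). The Hecke operators
    on cusp forms and on Dedekind symbols are sums over these $M$, and a summand
    of $R^m$ or $E^m$ at the matrix $g M$ is, up to a factor that depends on $M$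
    only, the summand of $R^1$ or $E^1$ at $g$ in the point moved by $M$. Hence
    $T_m R$ and the matrix sum of $T_m E$ are sums over $H_m$, arranged by
    orbits.

    For cusp forms this arrangement is legitimate because the sum converges
    absolutely ([summable_Rm_term]). Its terms are dominated by
    $1 / (|u|^2 |v|^2)$, where $u$, $v$ are the rows of the matrix; the identity
    $|u|^2 |v|^2 = (u.v)^2 + 1$ compares this sum over $SL_2(Z)$ with a product of
    three sums of $1 / (1 + x^2)$ ([sum_SL2]).

    For Dedekind symbols the matrix sums are finite ([finite_crossing]). The
    Bernoulli terms follow the distribution relation
    ([bernoulli_periodic_distribution]), and the last term counts the Hermite
    normal forms with weights ([hecke_Em_rat]).

    For period polynomials it is enough to compute $\beta_w(E^m) = S^m$ for
    every $m$, including $m = 1$ ([Em_reciprocity_rat]). Matrices with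
    $a b c d \ne 0$ contribute to $E^m(h,k) - E^m(k,-h)$ what they contribute to
    $S^m$, by an identity between signs ([crossing_sum_generic]). Matrices with a
    zero entry contribute power sums $\sum_{0 < j < x} (x - j)^n$, that is,
    differences between Bernoulli polynomials and periodic Bernoulli functions
    ([power_sum_below]), and so replace the latter by the former. Finally, a
    symbol $E$ with $\beta_w(E) = S_{w,n}$ differs from $E_{w,n}$ by a multiple
    of $gcd(h,k)^w$ ([invariant_symbol_gcd]), and the Hecke transform of
    $gcd(h,k)^w$ is killed by $\beta_w$ because right multiplication permutes the
    orbits ([hecke_gcd_rot]). *)

(** * Bernoulli polynomials *)

Local Notation B := bernoulli_poly.

Lemma bernoulli_rec p :
  \sum_(j < p.+1) 'C(p.+1, j)%:R *: B j = p.+1%:R *: 'X^p.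
Proof.
rewrite big_ord_recr /= [B p in LHS]bernoulli_polyE binSn scalerBr scalerA.
by rewrite mulfV ?pnatr_eq0 // scale1r addrC subrK.
Qed.

(** The system is triangular with diagonal coefficients $p + 1$, so it
    determines one member of the family after the other. *)
Lemma binomial_system_inj (V : lmodType rat) (P Q : nat -> V) :
  (forall p, \sum_(j < p.+1) 'C(p.+1, j)%:R *: P j =
             \sum_(j < p.+1) 'C(p.+1, j)%:R *: Q j) ->
  P =1 Q.
Proof.
move=> eqPQ j; have [n] := ubnP j; elim: n j => // n IHn j lt_jn.
have := eqPQ j; rewrite !big_ord_recr /= binSn.
rewrite (eq_bigr (fun i : 'I_j => 'C(j.+1, i)%:R *: Q i)) => [/addrI|i _].
  by apply: scalerI; rewrite pnatr_eq0.
by rewrite IHn // (leq_trans (ltn_ord i)).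
Qed.

(** Divided by $j + 1$, the derivatives solve the triangular system
    [bernoulli_rec], because deriving its equation of index $p + 1$ gives the
    one of index $p$. *)
Lemma deriv_bernoulli j : (B j.+1)^`() = j.+1%:R *: B j.
Proof.
suff <- : j.+1%:R^-1 *: (B j.+1)^`() = B j.
  by rewrite scalerA mulfV ?pnatr_eq0 // scale1r.
move: j; apply: binomial_system_inj => p; rewrite bernoulli_rec.
have := congr1 deriv (bernoulli_rec p.+1).
rewrite big_ord_recl /= bin0 derivD linear_sum [B 0]bernoulli_polyE big_ord0.
rewrite scaler0 subr0 expr0 derivZ derivC scaler0 add0r derivZ derivXn /=.
move/(congr1 (fun q => p.+2%:R^-1 *: q)).
rewrite scalerA mulVf ?pnatr_eq0 // scale1r -scaler_nat => <-.
rewrite scaler_sumr; apply: eq_bigr => i _.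
rewrite derivZ !scalerA; congr (_ *: _).
have /(congr1 (fun k => k%:R : rat)) := mul_bin_diag p.+2 i.
rewrite !natrM /= => e; apply: (mulfI (x := p.+2%:R)); rewrite ?pnatr_eq0 //.
rewrite !mulrA mulfV ?pnatr_eq0 // mul1r -mulrA [X in _ * X = _]mulrC mulrCA e.
by rewrite mulrA mulVf ?pnatr_eq0 // mul1r.
Qed.

(** Both sides solve the system [bernoulli_rec] with right-hand sides $(p + 1)
    (X + 1)^p$. *)
Lemma bernoulli_diff j : B j \Po ('X + 1) = B j + j%:R *: 'X^(j.-1).
Proof.
move: j; apply: binomial_system_inj => p.
have -> : \sum_(j < p.+1) 'C(p.+1, j)%:R *: (B j \Po ('X + 1)) =
          (\sum_(j < p.+1) 'C(p.+1, j)%:R *: B j) \Po ('X + 1).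
  by rewrite linear_sum; apply: eq_bigr => i _; rewrite linearZ.
under [RHS]eq_bigr do rewrite scalerDr.
rewrite big_split /= bernoulli_rec linearZ /= comp_Xn_poly.
rewrite [\sum_(i < p.+1) _]big_ord_recl /= scale0r scaler0 add0r.
have -> : ('X + 1 : {poly rat}) ^+ p = 'X^p + \sum_(i < p) 'C(p, i)%:R *: 'X^i.
  rewrite addrC [LHS]exprDn big_ord_recr /= subnn expr0 mul1r binn mulr1n addrC.
  by congr (_ + _); apply: eq_bigr => i _; rewrite expr1n mul1r scaler_nat.
rewrite scalerDr; congr (_ + _); rewrite scaler_sumr; apply: eq_bigr => i _.
rewrite !scalerA; congr (_ *: _).
by rewrite -!natrM mul_bin_diag mulnC.
Qed.

Lemma horner_bernoulli_diff j x : (B j).[x + 1] = (B j).[x] + j%:R * x ^+ j.-1.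
Proof.
have := congr1 (horner^~ x) (bernoulli_diff j).
by rewrite horner_comp !hornerE.
Qed.

(** The difference from the value at 0 has infinitely many zeros. *)
Lemma periodic_poly_const (p : {poly rat}) :
  (forall x, p.[x + 1] = p.[x]) -> p = (p.[0])%:P.
Proof.
move=> per_p; apply/eqP; rewrite -subr_eq0; apply: contraT => nz.
have pn n : p.[n%:R] = p.[0] by elim: n => // n <-; rewrite -natr1.
pose rs := [seq n%:R : rat | n <- iota 0 (size (p - p.[0]%:P))].
have := max_poly_roots nz (rs := rs); rewrite size_map size_iota ltnn.
apply; last by rewrite map_inj_uniq ?iota_uniq // => i j /eqP; rewrite eqr_nat => /eqP.
by apply/allP => _ /mapP[i _ ->]; rewrite rootE !hornerE pn subrr.
Qed.

(** If two families satisfy both conditions, the members of the family of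
    differences are periodic, hence constant, so their derivatives vanish; but
    these derivatives are multiples of the previous differences. *)
Lemma bernoulli_poly_unique (P : nat -> {poly rat}) :
    (forall j, (P j.+1)^`() = j.+1%:R *: P j) ->
    (forall j x, (P j).[x + 1] = (P j).[x] + j%:R * x ^+ j.-1) ->
  P =1 B.
Proof.
move=> dP diffP j; apply/eqP; rewrite -subr_eq0.
have /(congr1 deriv) : P j.+1 - B j.+1 = ((P j.+1 - B j.+1).[0])%:P.
  apply: periodic_poly_const => x; rewrite !hornerE diffP.
  by rewrite horner_bernoulli_diff opprD addrACA subrr addr0.
rewrite derivC derivB dP deriv_bernoulli -scalerBr => /eqP.
by rewrite scaler_eq0 pnatr_eq0 => /eqP->.
Qed.

(** The family $(-1)^j B_j(1 - X)$ has the derivatives and differences that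
    characterize $B_j$. *)
Lemma bernoulli_reflection j x : (B j).[1 - x] = (-1) ^+ j * (B j).[x].
Proof.
pose P j := (-1) ^+ j *: (B j \Po (1 - 'X)).
have PE i y : (P i).[y] = (-1) ^+ i * (B i).[1 - y].
  by rewrite hornerZ horner_comp !hornerE.
suff eqPB : P =1 B by rewrite -[in RHS]eqPB PE mulrA -expr2 sqrr_sign mul1r.
apply: bernoulli_poly_unique => [i|i y].
  rewrite derivZ deriv_comp deriv_bernoulli derivB derivC derivX sub0r mulrN1.
  by rewrite linearZ /= exprS mulN1r scaleNr scalerN opprK !scalerA mulrC.
rewrite !PE; have -> : 1 - y = 1 - (y + 1) + 1 by ring.
rewrite horner_bernoulli_diff.
case: i => [|i]; first by rewrite !mul0r addr0 addr0.
have -> : 1 - (y + 1) = - y by ring.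
rewrite /= [(- y) ^+ i]exprNn exprS.
have : (-1) ^+ i * (-1) ^+ i = 1 :> rat by rewrite -expr2 sqrr_sign.
move: ((-1) ^+ i) => e ee.
have -> : -1 * e * ((B i.+1).[- y] + i.+1%:R * (e * y ^+ i)) =
   -1 * e * (B i.+1).[- y] - i.+1%:R * (e * e) * y ^+ i by ring.
by rewrite ee; ring.
Qed.

(** The distribution relation: $d^{j-1} \sum_{b < d} B_j((x+b)/d)$ has the
    derivatives and, by telescoping, the differences that characterize $B_j$. *)
Lemma bernoulli_distribution j d x : (0 < d)%N ->
  d%:R ^+ j * \sum_(b < d) (B j).[(x + b%:R) / d%:R] = d%:R * (B j).[x].
Proof.
move=> d_gt0; have d_neq0 : d%:R != 0 :> rat by rewrite pnatr_eq0 -lt0n.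
pose lin (b : nat) : {poly rat} := d%:R^-1 *: ('X + b%:R%:P).
pose P j := (d%:R ^+ j / d%:R) *: \sum_(b < d) (B j \Po lin b).
have PE i y : (P i).[y] =
    d%:R ^+ i / d%:R * \sum_(b < d) (B i).[(y + b%:R) / d%:R].
  rewrite hornerZ horner_sum; congr (_ * _); apply: eq_bigr => b _.
  by rewrite horner_comp !hornerE mulrC.
suff eqPB : P =1 B.
  by rewrite -[in RHS]eqPB PE; field.
apply: bernoulli_poly_unique => [i|i y].
  rewrite derivZ linear_sum /= [RHS]scalerA [_ * (_ / _)]mulrC -[RHS]scalerA.
  rewrite !scaler_sumr; apply: eq_bigr => b _.
  rewrite deriv_comp deriv_bernoulli derivZ derivD derivX derivC addr0.
  rewrite linearZ /= -scalerAr mulr1 !scalerA; congr (_ *: _).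
  by rewrite exprS; field.
rewrite !PE; case: d d_gt0 d_neq0 {lin P PE} => // d _ d_neq0.
rewrite big_ord_recr big_ord_recl /= addr0.
have -> : (y + 1 + d%:R) / d.+1%:R = y / d.+1%:R + 1.
  by rewrite -addrA nat1r; field; rewrite nat1r.
rewrite horner_bernoulli_diff.
under eq_bigr do rewrite -addrA nat1r.
case: i => [|i]; first by rewrite !mul0r !addr0 addrC.
under [in RHS]eq_bigr do rewrite /bump add1n.
move: (\sum_(_ < d) _) => T.
rewrite /= expr_div_n exprS; field.
by rewrite nat1r expf_neq0 ?andbT.
Qed.

Lemma bernoulli_power_sum j x n :
  \sum_(i < n) (x + i%:R) ^+ j =
    ((B j.+1).[x + n%:R] - (B j.+1).[x]) / j.+1%:R.
Proof.
have j1 : j.+1%:R != 0 :> rat by rewrite pnatr_eq0.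
elim: n => [|n IHn]; first by rewrite big_ord0 addr0 subrr mul0r.
rewrite big_ord_recr /= IHn -[n.+1%:R]natr1 [x + (_ + 1)]addrA.
rewrite horner_bernoulli_diff /= addrAC [RHS]mulrDl; congr (_ + _).
by rewrite [RHS]mulrAC mulfV ?mul1r.
Qed.

(** ** Periodic Bernoulli functions *)

Local Notation Bp := bernoulli_periodic.

Lemma bernoulli_periodic_int j x (N : int) : Bp j (x + N%:~R) = Bp j x.
Proof.
rewrite /bernoulli_periodic floorDrz ?intr_int // intrKfloor intrD.
by congr (_.[_]); ring.
Qed.

(** The endpoint 1 is harmless because $B_j(1) = B_j(0)$ for $j \ne 1$. *)
Lemma bernoulli_periodic_id j x :
  j != 1 -> 0 <= x <= 1 -> Bp j x = (B j).[x].
Proof.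
move=> j1 /andP[x_ge0]; rewrite le_eqVlt => /orP[/eqP->|x_lt1].
  rewrite /bernoulli_periodic floor1 subrr -[1 in RHS]add0r horner_bernoulli_diff.
  by case: j j1 => [|[|j]] // _; rewrite ?mul0r ?addr0 // expr0n mulr0 addr0.
rewrite /bernoulli_periodic (_ : Num.floor x = 0) ?subr0 //.
by apply: floor_def; rewrite x_ge0.
Qed.

Lemma floor_decomposition (x : rat) :
  exists y (N : int), [/\ x = y + N%:~R, 0 <= y & y < 1].
Proof.
exists (x - (Num.floor x)%:~R), (Num.floor x); have /andP[le_fx lt_xf] := floor_itv x.
by rewrite subrK subr_ge0 le_fx ltrBlDr addrC -[X in _ + X]/(1%:~R) -intrD lt_xf.
Qed.

Lemma bernoulli_periodicN j x : j != 1 -> Bp j (- x) = (-1) ^+ j * Bp j x.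
Proof.
move=> j1; have [y [N [-> y_ge0 y_lt1]]] := floor_decomposition x.
rewrite bernoulli_periodic_int opprD -intrN bernoulli_periodic_int.
rewrite -(bernoulli_periodic_int j (- y) 1) [- y + _]addrC.
rewrite !bernoulli_periodic_id ?bernoulli_reflection //; first by rewrite y_ge0 ltW.
by apply/andP; split; lra.
Qed.

Lemma periodic_sum_shift (V : zmodType) (d : nat) (g : int -> V) (N : int) :
  (forall i, g (i + d%:Z) = g i) ->
  \sum_(b < d) g (N + b%:Z) = \sum_(b < d) g b%:Z.
Proof.
move=> per_g.
have step M : \sum_(b < d) g (M + 1 + b%:Z) = \sum_(b < d) g (M + b%:Z).
  case: d per_g => [|d] per_g; first by rewrite !big_ord0.
  rewrite big_ord_recr big_ord_recl /= addr0 addrC; congr (_ + _).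
    by rewrite -(per_g M); congr g; lia.
  by apply: eq_bigr => b _; congr g; rewrite /bump; lia.
elim/int_rec: N => [|n IHn|n IHn].
- by apply: eq_bigr => b _; rewrite add0r.
- by rewrite -[n.+1%:Z]/(Posz n.+1) -addn1 PoszD step.
- by rewrite -IHn -step; apply: eq_bigr => b _; congr g; lia.
Qed.

(** Both sides are periodic in $x$: a shift of $x$ by 1 rotates the sum over
    $b$ modulo $d$. For $0 \le x < 1$ all points $(x + b) / d$ lie in $[0,
    1)$. *)
Lemma bernoulli_periodic_distribution j d x : (0 < d)%N -> j != 1 ->
  d%:R ^+ j * \sum_(b < d) Bp j ((x + b%:R) / d%:R) = d%:R * Bp j x.
Proof.
move=> d_gt0 j1; have d_neq0 : d%:R != 0 :> rat by rewrite pnatr_eq0 -lt0n.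
have [y [N [-> y_ge0 y_lt1]]] := floor_decomposition x.
pose g (i : int) := Bp j ((y + i%:~R) / d%:R).
rewrite (eq_bigr (fun b : 'I_d => g (N + b%:Z))); last first.
  by move=> b _; rewrite /g intrD addrA.
rewrite periodic_sum_shift => [|i]; last first.
  rewrite /g intrD addrA mulrDl -[_%:~R / _]/(d%:R / d%:R) divff //.
  by rewrite (bernoulli_periodic_int j _ 1).
rewrite bernoulli_periodic_int bernoulli_periodic_id ?y_ge0 ?(ltW y_lt1) //.
rewrite -bernoulli_distribution //; congr (_ * _); apply: eq_bigr => b _.
rewrite /g bernoulli_periodic_id //; apply/andP; split.
  by rewrite divr_ge0 ?addr_ge0 // ler0n.
rewrite ler_pdivrMr ?mul1r ?ltr0n // (_ : d%:R = 1 + d.-1%:R).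
  by rewrite lerD ?(ltW y_lt1) // ler_nat -ltnS prednK.
by rewrite nat1r prednK.
Qed.

(** * Integer matrices of determinant m *)

Local Open Scope classical_set_scope.

Definition mx2 (a b c d : int) : 'M[int]_2 :=
  \matrix_(i < 2, j < 2)
    if i == 0 then (if j == 0 then a else b) else (if j == 0 then c else d).

Lemma mx2E a b c d :
  ((mx2 a b c d 0 0 = a) * (mx2 a b c d 0 1 = b) *
   (mx2 a b c d 1 0 = c) * (mx2 a b c d 1 1 = d))%type.
Proof. by rewrite !mxE. Qed.

Lemma mx2_eta (A : 'M[int]_2) : A = mx2 (A 0 0) (A 0 1) (A 1 0) (A 1 1).
Proof.
apply/matrixP => i j; rewrite mxE.
by case: i => [[|[|//]]] i2; case: j => [[|[|//]]] j2 /=;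
  congr (A _ _); apply: val_inj.
Qed.

Lemma mx2_eq (A A' : 'M[int]_2) :
  A 0 0 = A' 0 0 -> A 0 1 = A' 0 1 -> A 1 0 = A' 1 0 -> A 1 1 = A' 1 1 -> A = A'.
Proof. by rewrite [A]mx2_eta [A']mx2_eta !mx2E => -> -> -> ->. Qed.

Lemma mulmx2E (A A' : 'M[int]_2) i j :
  (A *m A') i j = A i 0 * A' 0 j + A i 1 * A' 1 j.
Proof. by rewrite mxE !big_ord_recl big_ord0 addr0; congr (_ + A _ _ * A' _ _); apply: val_inj. Qed.

Lemma inHE m (A : 'M[int]_2) : inH m A = (A 0 0 * A 1 1 - A 0 1 * A 1 0 == m%:Z).
Proof.
rewrite /inH (expand_det_row _ 0) !big_ord_recl big_ord0 /cofactor !det_mx11 !mxE.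
rewrite /= !expr0 expr1 addr0 mul1r mulN1r mulrN.
by congr (_ * _ - _ * _ == _); congr (A _ _); apply: val_inj.
Qed.

Lemma inH_mx2 m a b c d : inH m (mx2 a b c d) = (a * d - b * c == m%:Z).
Proof. by rewrite inHE !mx2E. Qed.

Lemma inH_mul m g A : inH 1 g -> inH m A -> inH m (g *m A).
Proof. by rewrite /inH det_mulmx => /eqP->; rewrite mul1r. Qed.

Definition adj2 (g : 'M[int]_2) := mx2 (g 1 1) (- g 0 1) (- g 1 0) (g 0 0).

Lemma inH_adj2 m g : inH m g -> inH m (adj2 g).
Proof. by rewrite inH_mx2 inHE => /eqP<-; apply/eqP; ring. Qed.

Lemma adj2_mul g : inH 1 g -> adj2 g *m g = 1%:M.
Proof.
rewrite inHE => /eqP dg.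
by apply: mx2_eq; rewrite !mulmx2E !mx2E !mxE /=; lia.
Qed.

Definition hermite (m d b : nat) : 'M[int]_2 := mx2 (m %/ d)%N b 0 d.

(** The matrices in Hermite normal form represent the orbits of $SL_2(Z)$ acting
    on $H_m$ by left multiplication. *)
Definition hermite_forms (m : nat) : seq 'M[int]_2 :=
  [seq hermite m d b | d <- divisors m, b <- iota 0 d].

Lemma big_hermite_forms (V : zmodType) m (G : 'M[int]_2 -> V) :
  \sum_(M <- hermite_forms m) G M =
  \sum_(d <- divisors m) \sum_(b < d) G (hermite m d b).
Proof.
rewrite big_allpairs_dep; apply: eq_bigr => d _.
by rewrite -(big_mkord xpredT (fun b => G (hermite m d b))) /index_iota subn0.
Qed.

Lemma mem_hermite_forms m (M : 'M[int]_2) : (0 < m)%N ->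
  reflect (exists a b d : nat, [/\ M = mx2 a b 0 d, (a * d = m)%N & (b < d)%N])
          (M \in hermite_forms m).
Proof.
move=> m_gt0; apply: (iffP allpairsPdep) => [[d [b [+ + ->]]]|[a [b [d [-> adm ltbd]]]]].
  rewrite -dvdn_divisors // mem_iota => /divnK adm ltbd.
  by exists (m %/ d)%N, b, d.
exists d, b; rewrite -dvdn_divisors // mem_iota add0n ltbd -adm dvdn_mull //.
split=> //; rewrite /hermite mulnK //; exact: leq_ltn_trans ltbd.
Qed.

Lemma uniq_hermite_forms m : (0 < m)%N -> uniq (hermite_forms m).
Proof.
move=> m_gt0; apply: allpairs_uniq_dep => [|d _|]; rewrite ?divisors_uniq ?iota_uniq //.
move=> [d b] [d' b'] /= _ _ eq_h.
have := congr1 (fun A : 'M[int]_2 => A 1 1) eq_h.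
have := congr1 (fun A : 'M[int]_2 => A 0 1) eq_h.
by rewrite !mx2E => -[->] [->].
Qed.

Lemma inH_hermite m M : (0 < m)%N -> M \in hermite_forms m -> inH m M.
Proof.
move=> m_gt0 /(mem_hermite_forms _ m_gt0)[a [b [d [-> adm _]]]].
by rewrite inH_mx2 mulr0 subr0 -PoszM adm.
Qed.

Lemma hermite_mulI m M (g g' : 'M[int]_2) : (0 < m)%N -> M \in hermite_forms m ->
  g *m M = g' *m M -> g = g'.
Proof.
move=> m_gt0 /(mem_hermite_forms _ m_gt0)[a [b [d [-> adm _]]]] eq_gM.
have := mulmx2E g (mx2 a b 0 d); rewrite eq_gM.
have a_gt0 : (0 < a)%N by lia.
have d_gt0 : (0 < d)%N by lia.
move=> E; have := (E 0 0, E 0 1, E 1 0, E 1 1).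
rewrite !mulmx2E !mx2E !mulr0 !addr0 => -[[[e1 e2] e3] e4].
have ann x y : x * a%:Z = y * a%:Z -> x = y by nia.
have dnn x y z : x + y * d%:Z = x + z * d%:Z -> y = z by nia.
have e1' := ann _ _ e1; have e3' := ann _ _ e3.
rewrite e1' in e2; rewrite e3' in e4.
by apply: mx2_eq; rewrite ?e1' ?e3' ?(dnn _ _ _ e2) ?(dnn _ _ _ e4).
Qed.

(** If $h M = M'$ with $h$ in $SL_2(Z)$, the zero entries make $h$ upper
    triangular, the positive diagonals make its diagonal entries 1, and the
    bounds on $b$ and $b'$ make its corner entry 0. *)
Lemma hermite_unique m M M' g g' : (0 < m)%N ->
    M \in hermite_forms m -> M' \in hermite_forms m -> inH 1 g -> inH 1 g' ->
  g *m M = g' *m M' -> M = M'.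
Proof.
move=> m_gt0 hM hM' hg hg' eq_gM.
pose h := adj2 g' *m g.
have hh : inH 1 h by apply: inH_mul hg; apply: inH_adj2.
have : h *m M = M' by rewrite -mulmxA eq_gM mulmxA adj2_mul // mul1mx.
move: h hh {eq_gM} => h; rewrite inHE => /eqP.
case/(mem_hermite_forms _ m_gt0): hM => a [b [d [-> adm ltbd]]].
case/(mem_hermite_forms _ m_gt0): hM' => a' [b' [d' [-> adm' ltbd']]].
have a_gt0 : (0 < a)%N by lia.
have a'_gt0 : (0 < a')%N by lia.
move=> dh E; have := (mulmx2E h (mx2 a b 0 d) 0 0, mulmx2E h (mx2 a b 0 d) 0 1,
  mulmx2E h (mx2 a b 0 d) 1 0, mulmx2E h (mx2 a b 0 d) 1 1).
rewrite E !mx2E => -[[[e1 e2] e3] e4].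
rewrite !mulr0 !addr0 in e1 e3; clear E.
move: (h 0 0) (h 0 1) (h 1 0) (h 1 1) dh e1 e2 e3 e4 => p q r s dh e1 e2 e3 e4.
have r0 : r = 0 by nia.
rewrite r0 ?mulr0 ?mul0r ?subr0 ?add0r in dh e4.
have p_gt0 : 0 < p by nia.
have s_gt0 : 0 < s by nia.
have [p1 s1] : p = 1 /\ s = 1 by nia.
rewrite p1 s1 !mul1r in e1 e2 e4.
have q0 : q = 0 by nia.
by rewrite q0 in e2; congr mx2; lia.
Qed.

(** The gcd of the first column of $A$ becomes the corner entry of $M$, a
    Bezout relation completes the reduced column to a matrix $g$, and
    Euclidean division by $d$ puts the remaining entry into its range. *)
Lemma hermite_exists m A : (0 < m)%N -> inH m A ->
  exists g M, [/\ M \in hermite_forms m, inH 1 g & A = g *m M].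
Proof.
move=> m_gt0; rewrite [A]mx2_eta inH_mx2.
move: (A 0 0) (A 0 1) (A 1 0) (A 1 1) => a b c d /eqP detA.
have g_gt0 : (0 < gcdz a c)%R.
  rewrite ltz_nat lt0n -eqz_nat -[Posz _]/(gcdz a c) gcdz_eq0.
  apply/negP => /andP[/eqP a0 /eqP c0]; subst; lia.
have [x [y bez]] : exists x y, x * a + y * c = gcdz a c.
  by case: (Bezoutz a c) => x [y e]; exists x, y.
have /dvdzP[a1 Ea] := dvdz_gcdl a c; have /dvdzP[c1 Ec] := dvdz_gcdr a c.
move: (gcdz a c) g_gt0 bez Ea Ec => g g_gt0 bez Ea Ec.
have bez1 : x * a1 + y * c1 = 1.
  by apply: (@mulIf _ g); [lia | rewrite mul1r -[in RHS]bez Ea Ec; ring].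
pose e := a1 * d - c1 * b; pose f := x * b + y * d.
have ge : g * e = m by rewrite -detA Ea Ec /e; ring.
have e_gt0 : 0 < e by nia.
exists (mx2 a1 (a1 * (f %/ e)%Z - y) c1 (c1 * (f %/ e)%Z + x)).
exists (mx2 g (f %% e)%Z 0 e); split.
- apply/(mem_hermite_forms _ m_gt0); exists `|g|%N, `|(f %% e)%Z|%N, `|e|%N.
  have := modz_ge0 f (lt0r_neq0 e_gt0); have := ltz_pmod f e_gt0.
  move: (f %% e)%Z => r lt_re r_ge0.
  split; [congr mx2; lia | | lia].
  by apply/eqP; rewrite -eqz_nat PoszM; apply/eqP; lia.
- by rewrite inH_mx2; apply/eqP; rewrite -[RHS]bez1; ring.
- have := divz_eq f e; move: (f %% e)%Z (f %/ e)%Z => r q fE.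
  apply: mx2_eq; rewrite !mulmx2E !mx2E ?mulr0 ?addr0 //.
    transitivity (a1 * f - y * e); last by rewrite fE; ring.
    by rewrite /f /e -[LHS]mul1r -bez1; ring.
  transitivity (c1 * f + x * e); last by rewrite fE; ring.
  by rewrite /f /e -[LHS]mul1r -bez1; ring.
Qed.

(** ** Finite sums over sets of matrices *)

Lemma finite_bounded_mx2 (P : set 'M[int]_2) (N : int) :
  (forall A, P A -> [/\ `|A 0 0| <= N, `|A 0 1| <= N, `|A 1 0| <= N & `|A 1 1| <= N]) ->
  finite_set P.
Proof.
move=> bP; pose r := [seq i%:Z - `|N|%:Z | i <- iota 0 (`|N|.*2.+1)].
have mem_r x : `|x| <= N -> x \in r.
  move=> xN; apply/mapP; exists `|(x + `|N|%:Z)%R|%N; last by lia.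
  by rewrite mem_iota; lia.
pose s := [seq mx2 p.1.1 p.1.2 p.2.1 p.2.2 |
            p <- [seq (x, y) | x <- [seq (x, y) | x <- r, y <- r],
                               y <- [seq (x, y) | x <- r, y <- r]]].
apply: (sub_finite_set _ (finite_seq s)) => A /bP[] b1 b2 b3 b4 /=.
apply/mapP; exists ((A 0 0, A 0 1), (A 1 0, A 1 1)); last exact: mx2_eta.
by rewrite !allpairs_f ?mem_r.
Qed.

Lemma raddf_fsum (V W : zmodType) (f : {additive V -> W}) (I : choiceType)
    (P : set I) (F : I -> V) : finite_set P ->
  f (\sum_(i \in P) F i) = \sum_(i \in P) f (F i).
Proof. by move=> finP; rewrite !fsbig_finite // raddf_sum. Qed.

Lemma fsbig_disjoint_bigU (V : zmodType) (I J : choiceType) (r : seq I)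
    (Q : I -> set J) (F : J -> V) :
    uniq r -> (forall i, i \in r -> finite_set (Q i)) ->
    (forall i j x, i \in r -> j \in r -> Q i x -> Q j x -> i = j) ->
  \sum_(x \in [set x | exists2 i, i \in r & Q i x]) F x =
  \sum_(i <- r) \sum_(x \in Q i) F x.
Proof.
elim: r => [|i r IHr] /=.
  by move=> _ _ _; rewrite big_nil fsbig1 // => x [].
move=> /andP[ir ur] finQ disjQ; rewrite big_cons -IHr //; first last.
- by move=> j k x jr kr; apply: disjQ; rewrite inE ?jr ?kr orbT.
- by move=> j jr; apply: finQ; rewrite inE jr orbT.
have -> : [set x | exists2 j, j \in i :: r & Q j x] =
          Q i `|` [set x | exists2 j, j \in r & Q j x].
  apply/seteqP; split=> x /=.
    by move=> [j]; rewrite inE => /orP[/eqP->|jr] Qj; [left | right; exists j].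
  by move=> [Qi|[j jr Qj]]; [exists i; rewrite ?mem_head | exists j; rewrite // inE jr orbT].
rewrite fsbigU0 //; first by apply: finQ; rewrite mem_head.
  have -> : [set x | exists2 j, j \in r & Q j x] = \bigcup_(j in [set` r]) Q j.
    by apply/seteqP; split=> x [j jr Qj]; exists j.
  by apply: bigcup_finite => // j jr; apply: finQ; rewrite inE [j \in r]jr orbT.
move=> x [Qi [j jr Qj]].
have eij : i = j by apply: (disjQ _ _ x); rewrite // inE ?eqxx // jr orbT.
by rewrite eij jr in ir.
Qed.

Lemma fsbig_hermite (V : zmodType) m (P : set 'M[int]_2) (F : 'M[int]_2 -> V) :
    (0 < m)%N ->
    (forall M, M \in hermite_forms m -> finite_set [set g | inH 1 g /\ P (g *m M)]) ->
  \sum_(A \in [set A | inH m A /\ P A]) F A =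
  \sum_(M <- hermite_forms m) \sum_(g \in [set g | inH 1 g /\ P (g *m M)]) F (g *m M).
Proof.
move=> m_gt0 finP.
pose Q M := (fun g => g *m M) @` [set g | inH 1 g /\ P (g *m M)].
transitivity (\sum_(M <- hermite_forms m) \sum_(A \in Q M) F A); last first.
  apply: eq_big_seq => M hM; apply: fsbig_image => g g' _ _ /=.
  exact: hermite_mulI hM.
rewrite -fsbig_disjoint_bigU ?uniq_hermite_forms //; first last.
- move=> M M' _ hM hM' [g [hg _] <-] [g' [hg' _] E].
  exact: (hermite_unique m_gt0 hM hM' hg hg' (esym E)).
- by move=> M hM; apply: finite_image; apply: finP.
apply: eq_fsbigl; apply/seteqP; split=> A /=.
  move=> [hA PA]; have [g [M [hM hg E]]] := hermite_exists m_gt0 hA.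
  exists M => //; exists g => //; split=> //; by rewrite -E.
by move=> [M hM [g [hg Pg] <-]]; split=> //; apply: inH_mul hg (inH_hermite m_gt0 hM).
Qed.

(** * The matrix sum of E^m *)

Definition top (A : 'M[int]_2) (h k : int) : int := A 0 0 * k + A 0 1 * h.
Definition bot (A : 'M[int]_2) (h k : int) : int := A 1 0 * k + A 1 1 * h.

Lemma top_mul A M h k : top (A *m M) h k = top A (bot M h k) (top M h k).
Proof. by rewrite /top /bot !mulmx2E; ring. Qed.

Lemma bot_mul A M h k : bot (A *m M) h k = bot A (bot M h k) (top M h k).
Proof. by rewrite /top /bot !mulmx2E; ring. Qed.

(** The sign condition of $E^m$, multiplied by the positive number $(h a c)^2$;
    it entails $a c \ne 0$. *)
Definition crossing (h k : int) : set 'M[int]_2 :=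
  [set A : 'M[int]_2 | A 0 0 * A 1 0 * top A h k * bot A h k < 0].

Definition weight (w n : nat) (h k : int) (A : 'M[int]_2) : int :=
  sgz (A 0 0 * top A h k) * top A h k ^+ (w - n) * bot A h k ^+ n.

(** For $P$ = [setT] this is twice the matrix sum of $E^m_{w,n}$; the predicate
    $P$ singles out the matrices with a given zero entry. *)
Definition crossing_sum (P : set 'M[int]_2) (w n m : nat) (h k : int) : int :=
  \sum_(A \in [set A : 'M[int]_2 | inH m A /\ (crossing h k A /\ P A)]) weight w n h k A.

(** As $a (c k + d h) - c (a k + b h) = m h$ and the two products have opposite
    signs, both are bounded by $|m h|$. *)
Lemma finite_crossing m h k : h != 0 ->
  finite_set [set A : 'M[int]_2 | inH m A /\ crossing h k A].
Proof.
move=> h0; apply: (@finite_bounded_mx2 _ (`|m%:Z * h| + `|m%:Z * h| * `|k|)) => A [].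
rewrite inHE /crossing /= /top /bot => /eqP.
move: (A 0 0) (A 0 1) (A 1 0) (A 1 1) => a b c d detA.
set u := a * k + b * h; set v := c * k + d * h => cr.
have E : a * v - c * u = m%:Z * h by rewrite -detA /u /v; ring.
have {}cr : (a * v) * (c * u) < 0 by rewrite (_ : _ * _ = a * c * u * v) //; ring.
have bound (x y z : int) : x * y < 0 -> x - y = z -> `|x| <= `|z| /\ `|y| <= `|z|.
  by nia.
have [av cu] := bound _ _ _ cr E; move: (m%:Z * h) av cu => z av cu.
have fact (x y : int) : x * y != 0 -> `|x * y| <= `|z| -> `|x| <= `|z| /\ `|y| <= `|z|.
  move=> xy0 xyz; have x0 : x != 0 by nia.
  have y0 : y != 0 by nia.
  by rewrite normrM in xyz; nia.
have av0 : a * v != 0 by apply: contraTneq cr => ->; rewrite mul0r ltxx.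
have cu0 : c * u != 0 by apply: contraTneq cr => ->; rewrite mulr0 ltxx.
have [az vz] := fact _ _ av0 av; have [cz uz] := fact _ _ cu0 cu.
have lift (x y t : int) : `|x| <= `|z| -> `|t| <= `|z| -> t = x * k + y * h ->
    `|y| <= `|z| + `|z| * `|k|.
  move=> xz tz tE; have yh : y * h = t - x * k by rewrite tE; ring.
  have : `|y * h| <= `|z| + `|z| * `|k|.
    rewrite yh (le_trans (ler_normB _ _)) // lerD // normrM ler_wpM2r //.
  by apply: le_trans; rewrite normrM ler_peMr //; lia.
have zk : 0 <= `|z| * `|k| by rewrite mulr_ge0.
split; [lia | exact: lift az uz _ | lia | exact: lift cz vz _].
Qed.

Lemma fsbig_bij (V : zmodType) (I J : choiceType) (f : I -> J) (g : J -> I)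
    (P : set I) (Q : set J) (F : J -> V) (G : I -> V) :
    cancel f g -> cancel g f ->
    (forall x, P x -> Q (f x)) -> (forall y, Q y -> P (g y)) ->
    (forall x, P x -> F (f x) = G x) ->
  \sum_(y \in Q) F y = \sum_(x \in P) G x.
Proof.
move=> fK gK PQ QP FG; rewrite (reindex_fsbig f P Q); last first.
  split=> [x /PQ //|x y _ _ /(can_inj fK) //|y /QP Py].
  by exists (g y).
by apply: eq_fsbigr => x /set_mem/FG.
Qed.

Section Symmetries.
Variables (P : set 'M[int]_2) (w n m : nat).

Lemma crossing_sum_period h k :
  crossing_sum setT w n m h (k + h) = crossing_sum setT w n m h k.
Proof.
pose f (A : 'M[int]_2) := mx2 (A 0 0) (A 0 1 - A 0 0) (A 1 0) (A 1 1 - A 1 0).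
pose g (A : 'M[int]_2) := mx2 (A 0 0) (A 0 1 + A 0 0) (A 1 0) (A 1 1 + A 1 0).
have topf A : top (f A) h (k + h) = top A h k by rewrite /top !mx2E; ring.
have botf A : bot (f A) h (k + h) = bot A h k by rewrite /bot !mx2E; ring.
have fg : cancel g f by move=> A; apply: mx2_eq; rewrite !mx2E; ring.
have gf : cancel f g by move=> A; apply: mx2_eq; rewrite !mx2E; ring.
apply: (fsbig_bij gf fg) => [A|A|A] /=; rewrite ?inHE ?/crossing /=.
- by rewrite topf botf !mx2E => -[/eqP<- [cr _]]; split=> //; apply/eqP; ring.
- rewrite -topf -botf fg !mx2E => -[/eqP<- [cr _]]; split=> //; first by apply/eqP; ring.
- by rewrite /weight topf botf !mx2E.
Qed.

Lemma crossing_sum_scale (c h k : int) : (n <= w)%N -> 0 < c ->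
  crossing_sum P w n m (c * h) (c * k) = c ^+ w * crossing_sum P w n m h k.
Proof.
move=> le_nw c_gt0.
have topc A : top A (c * h) (c * k) = c * top A h k by rewrite /top; ring.
have botc A : bot A (c * h) (c * k) = c * bot A h k by rewrite /bot; ring.
rewrite mulr_fsumr /crossing_sum.
have -> : crossing (c * h) (c * k) = crossing h k.
  have crE (x y t b : int) : x * y * (c * t) * (c * b) = c * (c * (x * y * t * b)).
    by ring.
  by apply/seteqP; split=> A; rewrite /crossing /= topc botc crE !(pmulr_rlt0 _ c_gt0).
apply: eq_fsbigr => A _; rewrite /weight topc botc mulrCA sgzM gtr0_sgz // mul1r.
by rewrite !exprMn -[in c ^+ w](subnK le_nw) exprD; ring.
Qed.

Lemma crossing_sum_opp (h k : int) :
  (forall A : 'M[int]_2, P (mx2 (- A 0 0) (A 0 1) (A 1 0) (- A 1 1)) <-> P A) ->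
  crossing_sum P w n m h (- k) = (-1) ^+ n.+1 * crossing_sum P w n m h k.
Proof.
move=> PE; rewrite mulr_fsumr.
pose f (A : 'M[int]_2) := mx2 (- A 0 0) (A 0 1) (A 1 0) (- A 1 1).
have topf k' A : top (f A) h (- k') = top A h k' by rewrite /top !mx2E; ring.
have botf k' A : bot (f A) h (- k') = - bot A h k' by rewrite /bot !mx2E; ring.
have ff : cancel f f by move=> A; apply: mx2_eq; rewrite !mx2E ?opprK.
have imf k' A : inH m A /\ (crossing h k' A /\ P A) ->
    inH m (f A) /\ (crossing h (- k') (f A) /\ P (f A)).
  rewrite !inHE /crossing /= topf botf !mx2E mulrNN => -[dA [cr /PE PA]].
  by split=> //; split=> //; rewrite mulrN !mulNr opprK.
apply: (fsbig_bij ff ff) => [A|A|A] /=; first exact: imf.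
  by move/imf; rewrite opprK.
move=> _; rewrite /weight topf botf !mx2E mulNr sgzN [(- bot A h k) ^+ _]exprNn exprS; ring.
Qed.

(** The row operation exchanges $a k + b h$ and $c k + d h$ up to a sign,
    hence the exponents $w - n$ and $n$. *)
Lemma crossing_sum_rowswap h k : (n <= w)%N ->
  crossing_sum [set A : 'M[int]_2 | P (mx2 (A 1 0) (A 1 1) (- A 0 0) (- A 0 1))] w n m h k =
  - (-1) ^+ (w - n) * crossing_sum P w (w - n) m h k.
Proof.
move=> le_nw; rewrite mulr_fsumr; apply: esym.
pose f (A : 'M[int]_2) := mx2 (A 1 0) (A 1 1) (- A 0 0) (- A 0 1).
pose g (A : 'M[int]_2) := mx2 (- A 1 0) (- A 1 1) (A 0 0) (A 0 1).
have topf A : top (f A) h k = bot A h k by rewrite /top /bot !mx2E.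
have botf A : bot (f A) h k = - top A h k by rewrite /bot /top !mx2E; ring.
have fg : cancel g f by move=> A; apply: mx2_eq; rewrite !mx2E ?opprK.
have gf : cancel f g by move=> A; apply: mx2_eq; rewrite !mx2E ?opprK.
have fP A : inH m (f A) /\ crossing h k (f A) <-> inH m A /\ crossing h k A.
  rewrite !inHE /crossing /= topf botf !mx2E.
  rewrite (_ : _ * - A 0 1 - _ = A 0 0 * A 1 1 - A 0 1 * A 1 0); last by ring.
  by rewrite (_ : _ * - top A h k = A 0 0 * A 1 0 * top A h k * bot A h k) //; ring.
apply: (fsbig_bij gf fg) => [A|A|A] /=.
- by move=> [dA [cr PA]]; have [] := (fP A).2 (conj dA cr).
- move=> [dA [cr PA]]; have [] := (fP (g A)).1; rewrite ?fg //.
  by move=> *; split=> //; split=> //; have := fg A; rewrite /f => ->.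
- move=> [_ [cr _]]; rewrite /weight topf botf subKn // !mx2E [(- top A h k) ^+ _]exprNn.
  suff -> : sgz (A 0 0 * top A h k) = - sgz (A 1 0 * bot A h k).
    rewrite mulNr -[RHS]mul1r -[in RHS](sqrr_sign _ (w - n)) expr2.
    by move: ((-1) ^+ (w - n)) => e; ring.
  move: cr; rewrite /crossing /= -sgz_lt0 !sgzM; nia.
Qed.

End Symmetries.

(** * Reciprocity *)

(** The sign condition excludes $a = 0$ and $c = 0$, and the determinant
    excludes $b = d = 0$. *)
Lemma crossing_sum_split w n m h k : m != 0 -> h != 0 ->
  crossing_sum setT w n m h k =
    crossing_sum [set A : 'M[int]_2 | A 0 0 * A 0 1 * A 1 0 * A 1 1 != 0] w n m h k
  + crossing_sum [set A : 'M[int]_2 | A 0 1 = 0] w n m h k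
  + crossing_sum [set A : 'M[int]_2 | A 1 1 = 0] w n m h k.
Proof.
move=> m0 h0; have fin (P : set 'M[int]_2) :
    finite_set [set A | inH m A /\ (crossing h k A /\ P A)].
  by apply: sub_finite_set (finite_crossing m k h0) => A /= [? []].
rewrite /crossing_sum -fsbigU0 ?fin //; last first.
  by move=> A [[_ [_ /eqP nz]] [_ [_ /= z]]]; apply: nz; rewrite z; ring.
rewrite -fsbigU0 ?finite_setU ?fin //; last first.
  move=> A [[[_ [_ /eqP nz]]|[dA [_ /= z]]] [_ [_ /= z']]].
    by apply: nz; rewrite z'; ring.
  by move: m0; move: dA; rewrite inHE z z' mulr0 mul0r subr0 eq_sym eqz_nat => ->.
apply: eq_fsbigl; apply/seteqP; split=> A /=; last by tauto.
move=> [dA [cr _]]; case: (eqVneq (A 0 1) 0) => [|b0]; first by tauto.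
case: (eqVneq (A 1 1) 0) => [|d0]; first by tauto.
left; left; split=> //; split=> //; rewrite !mulf_neq0 //.
  by apply: contraTneq cr => a0; rewrite /crossing /= a0 !mul0r ltxx.
by apply: contraTneq cr => c0; rewrite /crossing /= c0 mulr0 !mul0r ltxx.
Qed.

Lemma finite_Sm_index m : finite_set (Sm_index m).
Proof.
apply: (@finite_bounded_mx2 _ m%:Z) => A [].
rewrite inHE => /eqP; move: (A 0 0) (A 0 1) (A 1 0) (A 1 1) => a b c d detA abcd.
have ad_bc : (a * d) * (b * c) < 0.
  by rewrite (_ : _ * _ = a * b * c * d) //; ring.
have [ad bc] : `|a * d| <= m /\ `|b * c| <= m by nia.
have fact (x y : int) : x * y != 0 -> `|x * y| <= m -> `|x| <= m /\ `|y| <= m.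
  move=> xy0 xyz; have x0 : x != 0 by nia.
  have y0 : y != 0 by nia.
  by rewrite normrM in xyz; nia.
have ad0 : a * d != 0 by apply: contraTneq ad_bc => ->; rewrite mul0r ltxx.
have bc0 : b * c != 0 by apply: contraTneq ad_bc => ->; rewrite mulr0 ltxx.
by have [? ?] := fact _ _ ad0 ad; have [? ?] := fact _ _ bc0 bc; split.
Qed.

Lemma sgz_opposite (x y : int) : x * y < 0 -> sgz y = - sgz x.
Proof. by case: (sgzP x) => hx; case: (sgzP y) => hy //; nia. Qed.

(** If $a$ and $b$ have the same sign, then it is also the sign of $a k + b
    h$; otherwise the first two terms cancel. *)
Lemma sgz_combination (h k a b : int) : 0 < h -> 0 < k -> a != 0 -> b != 0 ->
    a * k + b * h != 0 ->
  sgz (a * (a * k + b * h)) + sgz (b * (a * k + b * h)) - sgz (a * b) = 1.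
Proof.
move=> h_gt0 k_gt0 a0 b0 u0; rewrite !sgzM.
case: (sgzP a) a0 => // ha _; case: (sgzP b) b0 => // hb _;
  case: (sgzP (a * k + b * h)) u0 => // hu _; nia.
Qed.

(** With $u = a k + b h$ and $v = c k + d h$, a sum over a sign condition such
    as $a c u v < 0$ is half a sum of $sgn(a u) - sgn(c v)$ without this
    condition. What remains is $sgn(a u) + sgn(b u) - sgn(a b) = 1$ if
    $u \ne 0$, and the same identity for $c$, $d$ and $v$. *)
Lemma crossing_sum_generic w n m (h k : int) : (0 < n < w)%N -> 0 < h -> 0 < k ->
  let P := [set A : 'M[int]_2 | A 0 0 * A 0 1 * A 1 0 * A 1 1 != 0] in
  crossing_sum P w n m h k - crossing_sum P w n m k (- h) =
  \sum_(A \in Sm_index m)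
    sgz (A 0 0 * A 0 1) * top A h k ^+ (w - n) * bot A h k ^+ n.
Proof.
move=> /andP[n_gt0 n_lt_w] h_gt0 k_gt0 P.
pose cr1 := [set A : 'M[int]_2 | A 0 0 * A 1 0 * top A h k * bot A h k < 0].
pose cr2 := [set A : 'M[int]_2 | A 0 1 * A 1 1 * top A h k * bot A h k < 0].
pose W A : int := top A h k ^+ (w - n) * bot A h k ^+ n.
have W0 A : top A h k * bot A h k = 0 -> W A = 0.
  move/eqP; rewrite mulf_eq0 /W => /orP[] /eqP->.
    by rewrite expr0n subn_eq0 leqNgt n_lt_w mul0r.
  by rewrite expr0n gtn_eqF // mulr0.
(* the rotation of the plane that exchanges (h, k) and (k, -h) *)
pose f (A : 'M[int]_2) := mx2 (- A 0 1) (A 0 0) (- A 1 1) (A 1 0).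
pose g (A : 'M[int]_2) := mx2 (A 0 1) (- A 0 0) (A 1 1) (- A 1 0).
have fg : cancel g f by move=> A; apply: mx2_eq; rewrite !mx2E ?opprK.
have gf : cancel f g by move=> A; apply: mx2_eq; rewrite !mx2E ?opprK.
have topf A : top (f A) k (- h) = top A h k by rewrite /top !mx2E; ring.
have botf A : bot (f A) k (- h) = bot A h k by rewrite /bot !mx2E; ring.
have fE A : inH m (f A) /\ (crossing k (- h) (f A) /\ P (f A)) <->
    inH m A /\ (cr2 A /\ P A).
  rewrite !inHE /crossing /P /cr2 /= topf botf !mx2E.
  have -> : - A 0 1 * A 1 0 - A 0 0 * - A 1 1 = A 0 0 * A 1 1 - A 0 1 * A 1 0 by ring.
  have -> : - A 0 1 * A 0 0 * - A 1 1 * A 1 0 = A 0 0 * A 0 1 * A 1 0 * A 1 1 by ring.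
  by rewrite mulrNN.
have rot : crossing_sum P w n m k (- h) =
    - \sum_(A \in [set A | inH m A /\ (cr2 A /\ P A)]) sgz (A 0 1 * top A h k) * W A.
  rewrite -[RHS]mulN1r mulr_fsumr; apply: (fsbig_bij gf fg) => [A /fE //|A|A _].
    by move=> hA; apply/fE; rewrite fg.
  by rewrite /weight topf botf !mx2E mulNr sgzN mulN1r /W -mulrA mulNr.
pose Q := [set A | inH m A /\ (P A /\ (cr1 A \/ cr2 A \/ Sm_index m A))].
have finQ : finite_set Q.
  pose Q0 := [set A | inH m A /\ crossing h k A] `|`
     (g @` [set A | inH m A /\ crossing k (- h) A] `|` Sm_index m).
  apply: (@sub_finite_set _ _ Q0) => [A|].
    move=> [dA [PA [cA|[cA|SA]]]]; [by left | right; left | by right; right].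
    by exists (f A) => //; have [d [c _]] := (fE A).2 (conj dA (conj cA PA)).
  rewrite !finite_setU; split; first by apply: finite_crossing; lia.
  split; last exact: finite_Sm_index.
  by apply: finite_image; apply: finite_crossing; lia.
have half (D : set 'M[int]_2) (x y : 'M[int]_2 -> int) :
    D `<=` Q -> (forall A, D A -> x A * y A < 0) ->
    (forall A, Q A -> ~ D A -> 0 < x A * y A \/ W A = 0) ->
    2 * (\sum_(A \in D) sgz (x A) * W A) = \sum_(A \in Q) (sgz (x A) - sgz (y A)) * W A.
  move=> DQ xyD xyQ; rewrite mulr_fsumr -(fsbig_widen D Q) //.
    by apply: eq_fsbigr => A /set_mem/xyD/sgz_opposite->; ring.
  move=> A [QA nDA]; rewrite /preimage /=; have [xy|->] := xyQ A QA nDA; last by rewrite mulr0.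
  have : sgz (x A) * sgz (y A) = 1 by rewrite -sgzM gtr0_sgz.
  by case: (sgzP (x A)) => hx; case: (sgzP (y A)) => hy //; rewrite subrr mul0r.
apply: (@mulfI _ 2%:Z) => //; rewrite rot opprK mulrDr.
have -> : crossing_sum P w n m h k =
    \sum_(A \in [set A | inH m A /\ (cr1 A /\ P A)]) sgz (A 0 0 * top A h k) * W A.
  by apply: eq_fsbigr => A _; rewrite /weight /W mulrA.
have -> : \sum_(A \in Sm_index m)
    sgz (A 0 0 * A 0 1) * top A h k ^+ (w - n) * bot A h k ^+ n =
   \sum_(A \in Sm_index m) sgz (A 0 0 * A 0 1) * W A.
  by apply: eq_fsbigr => A _; rewrite /W mulrA.
have split_uv A : W A = 0 \/ top A h k * bot A h k != 0.
  by case: (eqVneq (top A h k * bot A h k) 0) => [/W0|]; [left | right].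
rewrite (half _ (fun A => A 0 0 * top A h k) (fun A => A 1 0 * bot A h k)); first last.
- move=> A [dA [PA _]] nD; have [->|uv] := split_uv A; [by right | left].
  rewrite lt0r; apply/andP; split.
    by move: PA uv; rewrite /P /= !mulf_eq0 !negb_or => /andP[/andP[/andP[-> _] ->] _] /andP[-> ->].
  rewrite leNgt; apply/negP => cr; apply: nD; split=> //; split=> //.
  by move: cr; rewrite /cr1 /= mulrACA mulrA.
- by move=> A [_ [cr _]]; move: cr; rewrite /cr1 /= -mulrA mulrACA.
- by move=> A [dA [cr PA]]; split=> //; split=> //; left.
rewrite (half _ (fun A => A 0 1 * top A h k) (fun A => A 1 1 * bot A h k)); first last.
- move=> A [dA [PA _]] nD; have [->|uv] := split_uv A; [by right | left].
  rewrite lt0r; apply/andP; split.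
    by move: PA uv; rewrite /P /= !mulf_eq0 !negb_or => /andP[/andP[/andP[_ ->] _] ->] /andP[-> ->].
  rewrite leNgt; apply/negP => cr; apply: nD; split=> //; split=> //.
  by move: cr; rewrite /cr2 /= mulrACA mulrA.
- by move=> A [_ [cr _]]; move: cr; rewrite /cr2 /= -mulrA mulrACA.
- by move=> A [dA [cr PA]]; split=> //; split=> //; right; left.
rewrite (half _ (fun A => A 0 0 * A 0 1) (fun A => A 1 0 * A 1 1)); first last.
- move=> A [dA [PA _]] nD; left; move: PA; rewrite /P /= -mulrA lt0r => -> /=.
  by rewrite leNgt; apply/negP => cr; apply: nD; split=> //; rewrite mulrA in cr.
- by move=> A [_]; rewrite -mulrA.
- move=> A SA; case: (SA) => dA cr; split=> //; split; last by right; right.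
  by rewrite /P /=; apply: contraTneq cr => ->; rewrite ltxx.
rewrite -fsbig_split //; apply: eq_fsbigr => A /set_mem[_ [PA _]] /=; rewrite -mulrDl.
have [->|uv] := split_uv A; first by rewrite !mulr0.
congr (_ * _); move: uv; rewrite mulf_eq0 negb_or => /andP[u0 v0].
move: PA; rewrite /P /=.
rewrite !mulf_eq0 !negb_or => /andP[/andP[/andP[a0 b0] c0] d0].
have := sgz_combination h_gt0 k_gt0 a0 b0 u0.
have := sgz_combination h_gt0 k_gt0 c0 d0 v0.
by rewrite /top /bot; do 6! move: (sgz _) => ?; lia.
Qed.

(** If $y$ is the fractional part of $x$, the numbers $x - j$ are $y$, $y +
    1$, ..., $x - 1$, except that $y$ is missing for $y = 0$, where its power
    vanishes. *)
Lemma power_sum_below (n : nat) (x : rat) : (0 < n)%N -> 0 <= x ->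
  \sum_(j \in [set j : nat | (0 < j)%N /\ j%:R < x]) (x - j%:R) ^+ n =
    ((B n.+1).[x] - Bp n.+1 x) / n.+1%:R.
Proof.
move=> n_gt0 x_ge0; have [y [N [xE y_ge0 y_lt1]]] := floor_decomposition x.
have [M NM] : exists M : nat, N = M.
  case: N xE => [M|M] xE; first by exists M.
  have : (Negz M)%:~R <= -1 :> rat by rewrite -[-1]/((-1)%:~R) ler_int.
  by lra.
rewrite {}NM -pmulrn in xE; move=> {N}.
rewrite (fsbig_fwiden (iota 1 M)) ?iota_uniq //; first last.
- move=> j [/=]; rewrite mem_iota => /andP[j_gt0 j_le] /not_andP[//|/negP].
  rewrite -leNgt => xj; have {}xj : x = j%:R.
    apply/eqP; rewrite eq_le xj xE /= -[j%:R]add0r lerD //.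
    by rewrite ler_nat; lia.
  by rewrite /preimage /= xj subrr expr0n gtn_eqF.
- move=> j [j_gt0 jx] /=; rewrite mem_iota j_gt0 add1n /=.
  have : j%:R < 1 + M%:R :> rat by rewrite (lt_trans jx) // xE ltrD2r.
  by rewrite nat1r ltr_nat.
have -> : \sum_(j <- iota 1 M) (x - j%:R) ^+ n = \sum_(i < M) (y + i%:R) ^+ n.
  have -> : iota 1 M = index_iota 1 M.+1 by rewrite /index_iota subn1.
  rewrite big_add1 big_nat_rev /= add0n big_mkord; apply: eq_bigr => i _.
  rewrite xE -subSn // subSS -addrA natrB; last exact: ltnW.
  by congr (_ ^+ _); ring.
rewrite bernoulli_power_sum -xE xE (bernoulli_periodic_int _ _ M%:Z).
by rewrite (bernoulli_periodic_id (x := y)) ?y_ge0 ?(ltW y_lt1) // eqSS -lt0n.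
Qed.

(** A matrix with $b = 0$ is up to sign of the form (d, 0; -j, a) with $a d = m$;
    it crosses exactly if $0 < j < a h / k$. *)
Lemma crossing_sum_upper0 (w n m : nat) (h k : int) :
    ~~ odd w -> (0 < m)%N -> (0 < n <= w)%N -> 0 < h -> 0 < k ->
  (crossing_sum [set A : 'M[int]_2 | A 0 1 = 0] w n m h k)%:~R =
  2 * \sum_(a <- divisors m) (m %/ a)%N%:R ^+ (w - n) *
    (((B n.+1).[a%:R * h%:~R / k%:~R] - Bp n.+1 (a%:R * h%:~R / k%:~R))
      * k%:~R ^+ w / n.+1%:R) :> rat.
Proof.
move=> w_even m_gt0 /andP[n_gt0 le_nw] h_gt0 k_gt0.
have h0 : h != 0 by lia.
set S := [set A | inH m A /\ (crossing h k A /\ [set A : 'M[int]_2 | A 0 1 = 0] A)].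
have finS : finite_set S.
  by apply: sub_finite_set (finite_crossing m k h0) => A /= [? []].
pose pos : set 'M[int]_2 := [set A | 0 < A 0 0].
have -> : crossing_sum [set A : 'M[int]_2 | A 0 1 = 0] w n m h k =
    2 * \sum_(A \in S `&` pos) weight w n h k A.
  rewrite /crossing_sum -/S (fsbigID pos S) //= mulr2n mulrDl !mul1r; congr (_ + _).
  pose f (A : 'M[int]_2) := - A.
  have ff : cancel f f by move=> A; rewrite /f opprK.
  have topf A : top (f A) h k = - top A h k by rewrite /top !mxE; ring.
  have botf A : bot (f A) h k = - bot A h k by rewrite /bot !mxE; ring.
  have fS A : S A -> S (f A).
    rewrite /S /= !inHE /crossing /= topf botf !mxE !mulrNN => -[-> [cr ->]].
    by rewrite oppr0; split=> //; split=> //; rewrite -mulrA mulrNN mulrA.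
  have nz A : S A -> A 0 0 != 0.
    by move=> [_ [cr _]]; apply: contraTneq cr => a0; rewrite /crossing /= a0 !mul0r ltxx.
  apply: (fsbig_bij ff ff) => [A [SA Ap]|A [SA Ap]|A [SA Ap]].
  - split; [exact: fS | move: Ap; rewrite /pos /= mxE oppr_gt0 => a_gt0].
    by apply/negP; rewrite -leNgt ltW.
  - split; [exact: fS | move: Ap => /negP; rewrite /pos /= mxE oppr_gt0 -leNgt].
    by rewrite le_eqVlt (negbTE (nz _ SA)).
  - rewrite /weight topf botf mxE mulrNN [(- top A h k) ^+ _]exprNn.
    rewrite [(- bot A h k) ^+ _]exprNn.
    have : (-1) ^+ (w - n) * (-1) ^+ n = 1 :> int.
      by rewrite -exprD subnK // -signr_odd (negbTE w_even).
    move: ((-1) ^+ (w - n)) ((-1) ^+ n) => e e' ee'.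
    move: (top A h k ^+ _) (bot A h k ^+ n) (sgz _) => U V s.
    by transitivity (e * e' * (s * U * V)); [ring | rewrite ee' mul1r].
pose J (a : nat) := [set j : nat | (0 < j)%N /\ j%:Z * k < a%:Z * h].
have finJ a : finite_set (J a).
  apply: (sub_finite_set _ (finite_II `|(a%:Z * h)%R|%N)) => j [j_gt0 jk] /=.
  by nia.
pose g (a j : nat) := mx2 (m %/ a)%N 0 (- j%:Z) a.
have -> : S `&` pos = [set A | exists2 a, a \in divisors m & (g a @` J a) A].
  apply/seteqP; split=> A /=.
    rewrite /S /= inHE /crossing /= /top /bot /pos /= => -[[/eqP dA [cr b0]] a_gt0].
    rewrite b0 mul0r subr0 mul0r addr0 in dA cr.
    have d_gt0 : 0 < A 1 1 by nia.
    have ad : (absz (A 1%R 1%R) * absz (A 0%R 0%R))%N = m by lia.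
    have cd : 0 < - A 1 0 /\ - A 1 0 * k < A 1 1 * h.
      have : A 1 0 * (A 1 0 * k + A 1 1 * h) < 0.
        have a2k : 0 < A 0 0 * (A 0 0 * k) by rewrite !mulr_gt0.
        rewrite -(pmulr_rlt0 _ a2k).
        have E (x y z t : int) : x * y * z * t = x * z * (y * t) by ring.
        by rewrite E in cr.
      by nia.
    exists (absz (A 1 1)); first by rewrite -dvdn_divisors // -ad dvdn_mulr.
    exists (absz (A 1 0)); first by rewrite /J /=; lia.
    rewrite /g; apply: mx2_eq; rewrite !mx2E -?ad ?b0; try lia.
    by rewrite mulKn; lia.
  move=> [a]; rewrite -dvdn_divisors // => /divnK am [j [j_gt0 jkah] <-].
  rewrite /S /pos /= inHE /crossing /= /top /bot /g !mx2E.
  move: (m %/ a)%N am => p am.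
  have [p_gt0 a_gt0] : (0 < p)%N /\ (0 < a)%N by lia.
  split; last by rewrite ltz_nat.
  split; first by apply/eqP; lia.
  split=> //; rewrite mul0r addr0.
  have -> : p%:Z * - j%:Z * (p%:Z * k) * (- j%:Z * k + a%:Z * h) =
    - (p%:Z * j%:Z * (p%:Z * k) * (a%:Z * h - j%:Z * k)) by ring.
  rewrite oppr_lt0 !mulr_gt0 //; lia.
rewrite fsbig_disjoint_bigU ?divisors_uniq //; first last.
- move=> a a' A _ _ [j _ <-] [j' _ /(congr1 (fun A : 'M[int]_2 => A 1 1))].
  by rewrite !mx2E => -[].
- by move=> a _; apply: finite_image; apply: finJ.
rewrite intrM; congr (_ * _); rewrite rmorph_sum; apply: eq_big_seq => a.
rewrite -dvdn_divisors // => /divnK am.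
rewrite fsbig_image; last first.
  move=> j j' _ _ /(congr1 (fun A : 'M[int]_2 => A 1 0)).
  by rewrite !mx2E => /oppr_inj[].
have k0 : k%:~R != 0 :> rat by rewrite intr_eq0; lia.
have kR : 0 < k%:~R :> rat by rewrite ltr0z.
have x_ge0 : 0 <= a%:R * h%:~R / k%:~R :> rat.
  by rewrite divr_ge0 ?mulr_ge0 ?ler0z ?ler0n // ltW.
rewrite raddf_fsum //.
rewrite [_ * k%:~R ^+ w / _]mulrAC -power_sum_below // mulr_fsuml mulr_fsumr.
have -> : J a = [set j : nat | (0 < j)%N /\ j%:R < a%:R * h%:~R / k%:~R :> rat].
  apply/seteqP; split=> j; rewrite /J /= ltr_pdivlMr // !pmulrn -!intrM ltr_int //.
apply: eq_fsbigr => j /set_mem[j_gt0 jx].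
rewrite /weight /top /bot /g !mx2E mul0r addr0.
move: (m %/ a)%N am => p am; have p_gt0 : (0 < p)%N by lia.
rewrite gtr0_sgz ?mul1r; last by rewrite !mulr_gt0.
rewrite /= rmorphM !rmorphXn /= rmorphM rmorphD !rmorphM rmorphN /=.
have -> : k%:~R ^+ w = k%:~R ^+ (w - n) * k%:~R ^+ n :> rat by rewrite -exprD subnK.
have -> : - j%:~R * k%:~R + a%:~R * h%:~R =
    (a%:R * h%:~R / k%:~R - j%:R) * k%:~R :> rat by field.
by rewrite !exprMn; ring.
Qed.

(** Besides the terms of $S^m$, only matrices with a zero entry contribute to
    the difference. Those with $b = 0$ are counted directly; the other zero
    entries are moved to this place by exchanging the rows, or by passing from
    $(k, -h)$ to $(k, h)$. *)
Lemma crossing_sum_reciprocity (w n m : nat) (h k : int) :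
    ~~ odd w -> (0 < m)%N -> (0 < n < w)%N -> 0 < h -> 0 < k ->
  let gap j a (x y : int) : rat := ((B j.+1).[a%:R * x%:~R / y%:~R] -
    Bp j.+1 (a%:R * x%:~R / y%:~R)) * y%:~R ^+ w / j.+1%:R in
  (crossing_sum setT w n m h k - crossing_sum setT w n m k (- h))%:~R =
    (\sum_(A \in Sm_index m)
      sgz (A 0 0 * A 0 1) * top A h k ^+ (w - n) * bot A h k ^+ n)%:~R
  + 2 * \sum_(a <- divisors m) (m %/ a)%N%:R ^+ (w - n) *
      ((-1) ^+ n * gap n a k h + gap n a h k)
  - 2 * \sum_(a <- divisors m) (m %/ a)%N%:R ^+ n *
      (gap (w - n)%N a k h + (-1) ^+ n * gap (w - n)%N a h k) :> rat.
Proof.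
move=> w_even m_gt0 n_int h_gt0 k_gt0 gap; have [n_gt0 n_lt_w] := andP n_int.
have le_nw : (n <= w)%N by lia.
have m0 : m != 0 by lia.
pose Z j x y := \sum_(a <- divisors m) (m %/ a)%N%:R ^+ (w - j) * gap j a x y.
have zero_b j x y : (0 < j <= w)%N -> 0 < x -> 0 < y ->
    (crossing_sum [set A : 'M[int]_2 | A 0 1 = 0] w j m x y)%:~R = 2 * Z j x y.
  by move=> hj x0 y0; rewrite crossing_sum_upper0.
have zero_d j x y : (0 < j < w)%N -> 0 < x -> 0 < y ->
    (crossing_sum [set A : 'M[int]_2 | A 1 1 = 0] w j m x y)%:~R =
    - (-1) ^+ (w - j) * (2 * Z (w - j)%N x y) :> rat.
  move=> /andP[j0 jw] x0 y0; rewrite -zero_b ?subn_gt0 ?jw ?leq_subr //.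
  have := crossing_sum_rowswap [set A : 'M[int]_2 | A 0 1 = 0] m x y (ltnW jw).
  under eq_set do rewrite /= mx2E.
  by move=> ->; rewrite rmorphM rmorphN rmorphXn.
have opp P x y : (forall A : 'M[int]_2, P (mx2 (- A 0 0) (A 0 1) (A 1 0) (- A 1 1)) <-> P A) ->
    (crossing_sum P w n m x (- y))%:~R = (-1) ^+ n.+1 * (crossing_sum P w n m x y)%:~R :> rat.
  by move=> hP; rewrite crossing_sum_opp // rmorphM rmorphXn.
have sgnw : (-1) ^+ (w - n) = (-1) ^+ n :> rat.
  by rewrite -signr_odd oddB // (negbTE w_even) signr_odd.
rewrite -(crossing_sum_generic _ n_int h_gt0 k_gt0) !(crossing_sum_split w n) //; try lia.
rewrite !(rmorphB, rmorphD) /=.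
rewrite [X in _ - (_ + X + _)]opp; last by move=> A /=; rewrite mx2E.
rewrite [X in _ - (_ + _ + X)]opp; last first.
  by move=> A /=; rewrite mx2E; split=> [/eqP|->]; rewrite ?oppr0 // oppr_eq0 => /eqP.
have n_int' : (0 < n <= w)%N by rewrite n_gt0.
rewrite (zero_b n h k) // (zero_b n k h) // (zero_d n h k) // (zero_d n k h) //.
rewrite sgnw exprS.
have sumZ (f : nat -> rat) (e : rat) (g1 g2 : nat -> rat) :
    \sum_(a <- divisors m) f a * (e * g1 a + g2 a) =
    e * \sum_(a <- divisors m) f a * g1 a + \sum_(a <- divisors m) f a * g2 a.
  by rewrite mulr_sumr -big_split; apply: eq_bigr => a _ /=; ring.
rewrite (sumZ _ _ (gap n ^~ k ^~ h) (gap n ^~ h ^~ k)).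
under [X in _ = _ + _ - 2 * X]eq_bigr do rewrite addrC.
rewrite (sumZ _ _ (gap (w - n)%N ^~ h ^~ k) (gap (w - n)%N ^~ k ^~ h)).
rewrite -/(Z n k h) -/(Z n h k).
have Zn x y : \sum_(a <- divisors m) (m %/ a)%N%:R ^+ n * gap (w - n)%N a x y = Z (w - n)%N x y.
  by rewrite /Z subKn.
rewrite !Zn.
have : (-1) ^+ n * (-1) ^+ n = 1 :> rat by rewrite -expr2 sqrr_sign.
move: ((-1) ^+ n) (Z n h k) (Z n k h) (Z (w - n)%N h k) (Z (w - n)%N k h) => e z1 z2 z3 z4 ee.
have -> : -1 * e * (- e * (2 * z4)) = e * e * (2 * z4) by ring.
by rewrite ee; ring.
Qed.

(** * Dedekind symbols *)

Definition bernoulli_part (w n m : nat) (h k : int) : rat :=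
  \sum_(a <- divisors m)
    ((-1) ^+ n * (m %/ a)%N%:R ^+ (w - n)
       * (Bp n.+1 (a%:R * k%:~R / h%:~R) * h%:~R ^+ w / n.+1%:R)
     - (m %/ a)%N%:R ^+ n
       * (Bp (w - n).+1 (a%:R * k%:~R / h%:~R) * h%:~R ^+ w / (w - n).+1%:R)).

Definition Em_rat (w n m : nat) (h k : int) : rat :=
  2^-1 * (crossing_sum setT w n m h k)%:~R + bernoulli_part w n m h k
  + (sigma w.+1 m)%:R * kappa w n * h%:~R ^+ w.

Lemma EmE (R : realType) w n m h k : 0 < h ->
  Em R w n m h k = ratr (Em_rat w n m h k).
Proof.
move=> h_gt0; rewrite /Em /Em_rat.
set S2 := \sum_(a <- divisors m) _.
have -> : S2 = bernoulli_part w n m h k.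
  by rewrite /S2 /bernoulli_part; apply: eq_bigr => a _; rewrite -pmulrn.
set S1 := \sum_(A \in Em_index m h k) _.
suff -> : S1 = (crossing_sum setT w n m h k)%:~R by [].
rewrite {}/S1 {S2}.
have hR : 0 < h%:~R :> rat by rewrite ltr0z.
have slope (a b : int) : a != 0 -> k%:~R / h%:~R + b%:~R / a%:~R =
    (a * (a * k + b * h))%:~R / (a%:~R ^+ 2 * h%:~R) :> rat.
  rewrite -(intr_eq0 rat) => a0.
  by rewrite !(rmorphM, rmorphD) /=; field; rewrite a0 lt0r_neq0.
have den (a : int) : a != 0 -> 0 < (a%:~R ^+ 2 * h%:~R)^-1 :> rat.
  by rewrite -(intr_eq0 rat) => a0; rewrite invr_gt0 mulr_gt0 // exprn_even_gt0.
rewrite /crossing_sum raddf_fsum; last first.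
  apply: sub_finite_set (finite_crossing m k (lt0r_neq0 h_gt0)) => A /= [? []] //.
have -> : Em_index m h k = [set A | inH m A /\ (crossing h k A /\ setT A)].
  apply/seteqP; split=> A; rewrite /Em_index /crossing /=.
    move=> [dA ac cr]; split=> //; split=> //; move: cr; move: (ac).
    rewrite mulf_eq0 negb_or => /andP[a0 c0].
    rewrite !slope // mulrACA pmulr_llt0 ?mulr_gt0 ?den //.
    rewrite -intrM ltrz0 mulrACA mulrA /top /bot //.
  move=> [dA [cr _]]; have ac : A 0 0 * A 1 0 != 0.
    by apply: contraTneq cr => ->; rewrite !mul0r ltxx.
  split=> //; move: ac; rewrite mulf_eq0 negb_or => /andP[a0 c0].
  rewrite !slope // mulrACA pmulr_llt0 ?mulr_gt0 ?den //.
  by rewrite -intrM ltrz0 mulrACA mulrA.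
apply: eq_fsbigr => A /set_mem[_ [cr _]].
have a0 : A 0 0 != 0.
  by move: cr; apply: contraTneq => a0; rewrite /crossing /= a0 !mul0r ltxx.
rewrite /weight slope // sgrM [Num.sg (_^-1)]gtr0_sg ?den // mulr1.
by rewrite sgrEz sgz_int -!rmorphXn -!intrM.
Qed.

Lemma sum_divisors_rev (V : zmodType) m (F : nat -> V) : (0 < m)%N ->
  \sum_(a <- divisors m) F a = \sum_(d <- divisors m) F (m %/ d)%N.
Proof.
move=> m_gt0; rewrite -(big_map (fun d => m %/ d)%N xpredT F).
have divK d : (d %| m)%N -> (m %/ (m %/ d))%N = d.
  move=> dm; have q_gt0 : (0 < m %/ d)%N.
    by rewrite divn_gt0 ?(dvdn_gt0 m_gt0 dm) // dvdn_leq.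
  by rewrite -[X in (X %/ _)%N](divnK dm) mulKn.
apply: perm_big; apply: uniq_perm; rewrite ?divisors_uniq //.
  rewrite map_inj_in_uniq ?divisors_uniq // => a b.
  by rewrite -!dvdn_divisors // => am bm eq_ab; rewrite -(divK a am) eq_ab divK.
move=> d; rewrite -dvdn_divisors //; apply/idP/mapP => [dm|[a]].
  by exists (m %/ d)%N; rewrite ?divK // -dvdn_divisors // dvdn_div.
by rewrite -dvdn_divisors // => am ->; rewrite dvdn_div.
Qed.

(** The decomposition of $H_m$ into orbits: the normal form $M$ moves $(h, k)$
    to $(d h, a k + b h)$, and preserves the sign conditions because $a > 0$. *)
Lemma hecke_crossing_sum w n m h k : (0 < m)%N -> 0 < h ->
  \sum_(M <- hermite_forms m) crossing_sum setT w n 1 (bot M h k) (top M h k) =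
  crossing_sum setT w n m h k.
Proof.
move=> m_gt0 h_gt0.
have hM M : M \in hermite_forms m -> exists a b d : int,
    [/\ M = mx2 a b 0 d, 0 < a, 0 < d & bot M h k = d * h].
  move=> /(mem_hermite_forms _ m_gt0)[a [b [d [-> adm _]]]].
  exists a, b, d; split; rewrite ?ltz_nat //; try lia.
  by rewrite /bot !mx2E mul0r add0r.
have crM M g : M \in hermite_forms m ->
    crossing h k (g *m M) <-> crossing (bot M h k) (top M h k) g.
  move=> /hM[a [b [d [ME a0 d0 _]]]]; rewrite /crossing /= top_mul bot_mul.
  rewrite !mulmx2E ME !mx2E !mulr0 !addr0.
  have E (x y u v : int) : x * a * (y * a) * u * v = a * (a * (x * y * u * v)) by ring.
  by rewrite E !(pmulr_rlt0 _ a0).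
rewrite [RHS]fsbig_hermite //; last first.
  move=> M hMm; have [a [b [d [_ _ d0 botM]]]] := hM M hMm.
  have dh : bot M h k != 0 by rewrite botM; nia.
  apply: sub_finite_set (finite_crossing 1 (top M h k) dh) => g /= [hg [cr _]].
  by split=> //; apply/(crM M g hMm).
apply: eq_big_seq => M hMm; rewrite /crossing_sum.
have -> : [set g | inH 1 g /\ (crossing (bot M h k) (top M h k) g /\ setT g)] =
   [set g | inH 1 g /\ (crossing h k (g *m M) /\ setT (g *m M))].
  by apply/seteqP; split=> g /= [? [/(crM M g hMm) ? ?]].
apply: eq_fsbigr => g _; rewrite /weight top_mul bot_mul; congr (_ * _ * _).
have [a [b [d [ME a0 _ _]]]] := hM M hMm.
have [M00 M10] : M 0 0 = a /\ M 1 0 = 0 by rewrite ME !mx2E.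
by rewrite !sgzM mulmx2E M00 M10 mulr0 addr0 sgzM (gtr0_sgz a0) mulr1.
Qed.

Lemma bernoulli_part1 w n h k :
  bernoulli_part w n 1 h k =
    (-1) ^+ n * (Bp n.+1 (k%:~R / h%:~R) * h%:~R ^+ w / n.+1%:R)
    - Bp (w - n).+1 (k%:~R / h%:~R) * h%:~R ^+ w / (w - n).+1%:R.
Proof. by rewrite /bernoulli_part big_seq1 divnn !expr1n mulr1 !mul1r. Qed.

Lemma hecke_bernoulli_periodic w j (a d : nat) (h k : int) :
    (0 < d)%N -> (j <= w)%N -> j != 0 -> h != 0 ->
  \sum_(b < d) Bp j.+1 ((a%:Z * k + b%:Z * h)%:~R / (d%:Z * h)%:~R) * (d%:Z * h)%:~R ^+ w =
  d%:R ^+ (w - j) * (Bp j.+1 (a%:R * k%:~R / h%:~R) * h%:~R ^+ w).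
Proof.
move=> d_gt0 le_jw j0; rewrite -(intr_eq0 rat) => h0.
have d0 : d%:R != 0 :> rat by rewrite pnatr_eq0 -lt0n.
rewrite -mulr_suml (eq_bigr (fun b : 'I_d => Bp j.+1 ((a%:R * k%:~R / h%:~R + b%:R) / d%:R))).
  apply: (mulfI (x := d%:R ^+ j.+1)); first by rewrite expf_neq0.
  have := @bernoulli_periodic_distribution j.+1 d (a%:R * k%:~R / h%:~R) d_gt0 j0.
  move=> E; rewrite [LHS]mulrA E {E} rmorphM exprMn.
  by rewrite -[in d%:~R ^+ w](subnK le_jw) exprD exprS; ring.
move=> b _; rewrite rmorphD !rmorphM /=; congr Bp; field.
by rewrite h0 d0.
Qed.

Lemma hecke_bernoulli_part w n m h k : (0 < m)%N -> (0 < n < w)%N -> h != 0 ->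
  \sum_(d <- divisors m) \sum_(b < d)
    bernoulli_part w n 1 (d%:Z * h) ((m %/ d)%N%:Z * k + b%:Z * h) =
  bernoulli_part w n m h k.
Proof.
move=> m_gt0 /andP[n_gt0 n_lt_w] h0; rewrite [RHS]sum_divisors_rev //.
apply: eq_big_seq => d; rewrite -dvdn_divisors // => dm.
have d_gt0 := dvdn_gt0 m_gt0 dm.
have -> : (m %/ (m %/ d))%N = d.
  by rewrite -[X in (X %/ _)%N](divnK dm) mulKn // divn_gt0 // dvdn_leq.
under eq_bigr do rewrite bernoulli_part1 mulrA.
rewrite sumrB -mulr_suml -mulr_sumr -[X in _ - X]mulr_suml.
rewrite !hecke_bernoulli_periodic ?subKn ?leq_subr -?lt0n ?subn_gt0 // ?(ltnW n_lt_w) //.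
by rewrite !mulrA.
Qed.

Lemma sigma1 k : sigma k 1 = 1%N.
Proof. by rewrite /sigma big_seq1 exp1n. Qed.

Lemma hecke_Em_rat w n m h k : (0 < m)%N -> (0 < n < w)%N -> 0 < h ->
  \sum_(d <- divisors m) \sum_(b < d)
    Em_rat w n 1 (d%:Z * h) ((m %/ d)%N%:Z * k + b%:Z * h) =
  Em_rat w n m h k.
Proof.
move=> m_gt0 n_int h_gt0; have h0 := lt0r_neq0 h_gt0.
rewrite /Em_rat -(hecke_bernoulli_part k m_gt0 n_int h0).
rewrite -(hecke_crossing_sum w n k m_gt0 h_gt0) big_hermite_forms.
rewrite [X in 2^-1 * X]rmorph_sum /= mulr_sumr.
have -> : (sigma w.+1 m)%:R = \sum_(d <- divisors m) (d ^ w.+1)%:R :> rat.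
  by rewrite natr_sum.
rewrite !mulr_suml -!big_split /=.
apply: eq_bigr => d _; rewrite [X in 2^-1 * X]rmorph_sum /= mulr_sumr sigma1.
have -> : (d ^ w.+1)%:R * kappa w n * h%:~R ^+ w =
    \sum_(b < d) 1 * kappa w n * (d%:Z * h)%:~R ^+ w :> rat.
  by rewrite sumr_const card_ord -mulr_natl rmorphM exprMn natrX exprS /=; ring.
rewrite -!big_split; apply: eq_bigr => b _ /=.
by rewrite /hermite /top /bot !mx2E mul0r add0r.
Qed.

Lemma hecke_Em (R : realType) w n m h k : (0 < m)%N -> (0 < n < w)%N -> 0 < h ->
  hecke_dedekind m (@Em R w n 1) h k = Em R w n m h k.
Proof.
move=> m_gt0 n_int h_gt0; rewrite EmE // -hecke_Em_rat // rmorph_sum.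
apply: eq_big_seq => d; rewrite -dvdn_divisors // => /(dvdn_gt0 m_gt0) d_gt0.
by rewrite rmorph_sum; apply: eq_bigr => b _; rewrite EmE // mulr_gt0.
Qed.

(** ** Symmetries and reciprocity of Em *)

Lemma Em_period (R : realType) w n h k : 0 < h ->
  Em R w n 1 h (k + h) = Em R w n 1 h k.
Proof.
move=> h_gt0; rewrite !EmE // /Em_rat crossing_sum_period !bernoulli_part1.
rewrite intrD mulrDl divff ?intr_eq0 ?lt0r_neq0 //.
by rewrite !(bernoulli_periodic_int _ _ 1).
Qed.

Lemma Em_scale (R : realType) w n (c h k : int) : (n <= w)%N -> 0 < c -> 0 < h ->
  Em R w n 1 (c * h) (c * k) = c%:~R ^+ w * Em R w n 1 h k.
Proof.
move=> le_nw c_gt0 h_gt0; rewrite !EmE ?mulr_gt0 //.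
rewrite -(ratr_int _ c) -rmorphXn -rmorphM; congr ratr.
rewrite /Em_rat crossing_sum_scale // !bernoulli_part1 !intrM [(c ^+ w)%:~R]rmorphXn /=.
rewrite -mulf_div divff ?intr_eq0 ?lt0r_neq0 // mul1r exprMn; ring.
Qed.

Lemma Em_parity (R : realType) w n h k :
    ~~ odd w -> (0 < n < w)%N -> 0 < h ->
  Em R w n 1 h (- k) = (-1) ^+ n.+1 * Em R w n 1 h k.
Proof.
move=> w_even /andP[n_gt0 n_lt_w] h_gt0; rewrite !EmE //.
rewrite -[(-1) ^+ _ in RHS](rmorph_sign ratr) -rmorphM; congr ratr.
rewrite /Em_rat crossing_sum_opp // !bernoulli_part1.
rewrite intrM [((-1) ^+ _)%:~R]rmorph_sign intrN mulNr.
rewrite !bernoulli_periodicN ?eqSS -?lt0n ?subn_gt0 //.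
have -> : (-1) ^+ (w - n).+1 = (-1) ^+ n.+1 :> rat.
  by rewrite -signr_odd /= oddB 1?ltnW // (negbTE w_even) -[RHS]signr_odd.
have kE : (-1) ^+ n.+1 * kappa w n = kappa w n.
  rewrite /kappa -signr_odd /=; case: (odd n) => /=; first by rewrite mul1r.
  by rewrite mulr0.
rewrite -[in LHS]kE; move: (kappa w n) ((-1) ^+ n.+1) ((-1) ^+ n) => K e e'.
by move: (Bp _ _) (Bp _ _) => b b'; ring.
Qed.

(** The Bernoulli terms at $(k, -h)$ are reflected to $(k, h)$; what the
    matrix sums contribute then cancels all periodic Bernoulli functions. *)
Lemma Em_reciprocity_rat w n m h k :
    ~~ odd w -> (0 < m)%N -> (0 < n < w)%N -> 0 < h -> 0 < k ->
  let poly j a (x y : int) : rat :=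
    (B j.+1).[a%:R * x%:~R / y%:~R] * y%:~R ^+ w in
  Em_rat w n m h k - Em_rat w n m k (- h) =
  2^-1 * (\sum_(A \in Sm_index m)
      sgz (A 0 0 * A 0 1) * top A h k ^+ (w - n) * bot A h k ^+ n)%:~R
  + \sum_(a <- divisors m) (m %/ a)%N%:R ^+ (w - n) / n.+1%:R *
      ((-1) ^+ n * poly n a k h + poly n a h k)
  - \sum_(a <- divisors m) (m %/ a)%N%:R ^+ n / (w - n).+1%:R *
      (poly (w - n)%N a k h + (-1) ^+ n * poly (w - n)%N a h k)
  + (sigma w.+1 m)%:R * kappa w n * (h%:~R ^+ w - k%:~R ^+ w).
Proof.
move=> w_even m_gt0 n_int h_gt0 k_gt0 poly; have [n_gt0 n_lt_w] := andP n_int.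
have := crossing_sum_reciprocity w_even m_gt0 n_int h_gt0 k_gt0.
set gap := fun _ => _ => /=; rewrite rmorphB /= => E.
have -> : Em_rat w n m h k - Em_rat w n m k (- h) =
    2^-1 * ((crossing_sum setT w n m h k)%:~R - (crossing_sum setT w n m k (- h))%:~R)
    + (bernoulli_part w n m h k - bernoulli_part w n m k (- h))
    + (sigma w.+1 m)%:R * kappa w n * (h%:~R ^+ w - k%:~R ^+ w).
  by rewrite /Em_rat; ring.
rewrite {}E -sumrB; congr (_ + _).
have half (x y z : rat) : 2^-1 * (x + 2 * y - 2 * z) = 2^-1 * x + (y - z) by field.
rewrite half -addrA -sumrB -big_split -[in RHS]addrA -sumrB; congr (_ + _).
apply: eq_bigr => a _ /=; rewrite intrN mulrN mulNr.
rewrite !bernoulli_periodicN ?eqSS -?lt0n ?subn_gt0 //.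
have -> : (-1) ^+ (w - n).+1 = (-1) ^+ n.+1 :> rat.
  by rewrite -signr_odd /= oddB 1?ltnW // (negbTE w_even) -[RHS]signr_odd.
rewrite /gap /poly exprS.
have : (-1) ^+ n * (-1) ^+ n = 1 :> rat by rewrite -expr2 sqrr_sign.
have : n.+1%:R != 0 :> rat by rewrite pnatr_eq0.
have : (w - n).+1%:R != 0 :> rat by rewrite pnatr_eq0.
move: ((-1) ^+ n) (m %/ a)%N%:R => e D.
move: n.+1%:R (w - n).+1%:R (D ^+ n) (D ^+ (w - n)) => N N' D1 D2.
move: (Bp _ _) (Bp _ _) (Bp _ _) (Bp _ _) => b1 b2 b3 b4.
move: (_.[_]) (_.[_]) (_.[_]) (_.[_]) (_ ^+ w) (_ ^+ w) => c1 c2 c3 c4 H K.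
move=> N0 N'0 ee.
rewrite (_ : e * D2 * (-1 * e * b3 * H / N) = - (e * e) * D2 * b3 * H / N); last by ring.
by rewrite ee; field; rewrite N0 N'0.
Qed.

(** ** The period polynomial *)

Lemma size_bernoulli_poly j : (size (B j) <= j.+1)%N.
Proof.
have [n] := ubnP j; elim: n j => // n IHn j lt_jn.
rewrite bernoulli_polyE (leq_trans (size_polyD _ _)) // geq_max size_polyXn leqnn /=.
rewrite size_polyN (leq_trans (size_scale_leq _ _)) //.
apply: (leq_trans (size_sum _ _ _)); apply/bigmax_leqP => i _.
rewrite (leq_trans (size_scale_leq _ _)) // ltnW // ltnS.
by rewrite (leq_trans (IHn i _)) // (leq_trans (ltn_ord i)).
Qed.

Section PeriodPolynomial.
Variable R : realType.
Local Notation C := R[i].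
Implicit Types (h k : int).

Lemma meval_bernoulli_hom (v : 'I_2 -> C) w j a (x y : mpoly 2 C) h k :
    (j <= w)%N -> h != 0 -> meval v x = h%:~R -> meval v y = k%:~R ->
  meval v (bernoulli_hom w j a x y) =
  ratr ((B j).[a%:R * k%:~R / h%:~R] * h%:~R ^+ w).
Proof.
move=> le_jw h0 vx vy; rewrite raddf_sum (horner_coef_wide _ (size_bernoulli_poly j)).
rewrite mulr_suml rmorph_sum; apply: eq_bigr => i _ /=.
rewrite mevalZ mevalM !rmorphXn /= mevalM rmorph_nat vx vy -mulrA rmorphM /=.
congr (_ * _); have h1 : h%:~R != 0 :> rat by rewrite intr_eq0.
have le_iw : (i <= w)%N by rewrite (leq_trans _ le_jw) // -ltnS.
rewrite -[in RHS](subnKC le_iw) exprD mulrA -exprMn mulfVK //.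
by rewrite -!(ratr_int C) -(ratr_nat C) -rmorphM -!rmorphXn -rmorphM.
Qed.

Lemma eval2_Sm w n m h k :
    ~~ odd w -> (0 < m)%N -> (0 < n < w)%N -> 0 < h -> 0 < k ->
  eval2 (Sm R w n m) h%:~R k%:~R = ratr (Em_rat w n m h k - Em_rat w n m k (- h)).
Proof.
move=> w_even m_gt0 n_int h_gt0 k_gt0; have /andP[n_gt0 n_lt_w] := n_int.
rewrite Em_reciprocity_rat // /eval2; set v := fun i : 'I_2 => _.
have vh : meval v (var_h R) = h%:~R by rewrite /var_h mevalXU.
have vk : meval v (var_k R) = k%:~R by rewrite /var_k mevalXU.
have h0 := lt0r_neq0 h_gt0; have k0 := lt0r_neq0 k_gt0.
have le_wn : ((w - n).+1 <= w)%N by lia.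
rewrite /Sm mevalD mevalB mevalD !mevalZ mevalB !rmorphXn /= vh vk.
have ratr4 (x y z t : rat) :
    ratr (x + y - z + t) = ratr x + ratr y - ratr z + ratr t :> C.
  by rewrite !(rmorphD, rmorphN).
have ratr_term (D N j : nat) (x y : C) (p q : rat) : x = ratr p -> y = ratr q ->
    D%:R ^+ j / N%:R * ((-1) ^+ n * x + y) =
    ratr (D%:R ^+ j / N%:R * ((-1) ^+ n * p + q)).
  move=> -> ->; rewrite -(ratr_nat C D) -(ratr_nat C N) -fmorphV -rmorphXn -rmorphM.
  by rewrite -[(-1) ^+ n](rmorph_sign ratr) -rmorphM -rmorphD -rmorphM.
rewrite ratr4; congr (_ + _ - _ + _).
- rewrite [RHS]rmorphM fmorphV rmorph_nat; congr (_ * _).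
  have finS := finite_Sm_index m.
  rewrite /= ratr_int (fsbig_finite _ _ finS) /= (fsbig_finite _ _ finS) /= !raddf_sum.
  apply: eq_bigr => A _; rewrite /= !mevalM !rmorphXn /= !mevalD !mevalM.
  rewrite !rmorph_int vh vk /top /bot sgrEz intz.
  by rewrite -!intrM -!intrD -!rmorphXn -!intrM.
- rewrite raddf_sum rmorph_sum; apply: eq_bigr => a _.
  rewrite [LHS]mevalZ mevalD mevalM rmorph_sign; apply: ratr_term.
    exact: meval_bernoulli_hom n_lt_w h0 vh vk.
  exact: meval_bernoulli_hom n_lt_w k0 vk vh.
- rewrite raddf_sum rmorph_sum; apply: eq_bigr => a _.
  rewrite [LHS]mevalZ mevalD mevalM rmorph_sign addrC [X in _ = ratr (_ * X)]addrC.
  apply: ratr_term; first exact: meval_bernoulli_hom le_wn k0 vk vh.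
  exact: meval_bernoulli_hom le_wn h0 vh vk.
- rewrite -(ratr_nat C (sigma w.+1 m)) -!(ratr_int C) -rmorphM -!rmorphXn -rmorphB.
  by rewrite -rmorphM.
Qed.

Lemma homogeneous_Sm w n m : (0 < n < w)%N -> homogeneous w (Sm R w n m).
Proof.
move=> n_int; have [n_gt0 n_lt_w] := andP n_int.
have hvar (i : 'I_2) : mpolyX C (mnm1 i) \is @ishomog1 2 C 1 (@mdeg 2).
  by rewrite dhomogX /= mdeg1.
have hh : var_h R \is @ishomog1 2 C 1 (@mdeg 2) by exact: hvar.
have hk : var_k R \is @ishomog1 2 C 1 (@mdeg 2) by exact: hvar.
have hX j (x : mpoly 2 C) : x \is @ishomog1 2 C 1 (@mdeg 2) ->
    x ^+ j \is @ishomog1 2 C j (@mdeg 2).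
  by move=> hx; rewrite -[j in ishomog1 j]mul1n dhomogMn.
have hsc d (c : int) (x : mpoly 2 C) : x \is @ishomog1 2 C d (@mdeg 2) ->
    c%:~R * x \is @ishomog1 2 C d (@mdeg 2).
  by move=> hx; rewrite mulrzl rpredMz.
have hsgn d e (x : mpoly 2 C) : x \is @ishomog1 2 C d (@mdeg 2) ->
    (-1) ^+ e * x \is @ishomog1 2 C d (@mdeg 2).
  by move=> hx; rewrite -signr_odd; case: (odd e); rewrite ?expr1 ?mulN1r ?mul1r ?rpredN.
have hM d e (p q : mpoly 2 C) : (d + e)%N = w -> p \is @ishomog1 2 C d (@mdeg 2) ->
    q \is @ishomog1 2 C e (@mdeg 2) -> p * q \is @ishomog1 2 C w (@mdeg 2).
  by move=> <- hp hq; apply: dhomogM.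
have hB j a x y : (j <= w)%N -> x \is @ishomog1 2 C 1 (@mdeg 2) ->
    y \is @ishomog1 2 C 1 (@mdeg 2) -> bernoulli_hom w j a x y \is @ishomog1 2 C w (@mdeg 2).
  move=> le_jw hx hy; apply: rpred_sum => i _; apply: rpredZ.
  have le_iw : (i <= w)%N by rewrite (leq_trans _ le_jw) // -ltnS.
  by apply: (hM i (w - i)%N); rewrite ?subnKC ?hX // mulr_natl rpredMn.
rewrite /homogeneous /Sm; apply: rpredD; last by rewrite rpredZ // rpredB ?hX.
apply: rpredB; first apply: rpredD.
- apply: rpredZ; apply: rpred_sum => A _ /=.
  by apply: (hM (w - n)%N n); rewrite ?subnK ?(ltnW n_lt_w) ?hsc ?hX ?rpredD ?hsc.
- by apply: rpred_sum => a _; rewrite rpredZ // rpredD ?hsgn ?hB.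
- by apply: rpred_sum => a _; rewrite rpredZ // rpredD ?hsgn ?hB //; lia.
Qed.

End PeriodPolynomial.

(** ** Symbols with vanishing period polynomial *)

(** The Euclidean algorithm reduces $(h, k)$ to $(gcd(h, k), 0)$. *)
Lemma invariant_symbol_gcd (F : comNzRingType) w (D : int -> int -> F) :
    (forall h k, 0 < h -> D h k = D h (k + h)) ->
    (forall c h k, 0 < c -> 0 < h -> D (c * h) (c * k) = c%:~R ^+ w * D h k) ->
    (forall h k, 0 < h -> 0 < k -> D h k = D k (- h)) ->
  forall h k, 0 < h -> D h k = (gcdz h k)%:~R ^+ w * D 1 0.
Proof.
move=> perD scaleD rotD.
have perDz h k N : 0 < h -> D h (k + N * h) = D h k.
  move=> h0; elim/int_rec: N => [|N IHN|N IHN]; first by rewrite mul0r addr0.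
    by rewrite -{}IHN [RHS]perD //; congr (D h _); lia.
  by rewrite -{}IHN [LHS]perD //; congr (D h _); lia.
move=> h; have [N] := ubnP `|h|%N; elim: N h => // N IHN h lt_hN k h_gt0.
have -> : D h k = D h (k %% h)%Z by rewrite {1}(divz_eq k h) addrC perDz.
rewrite -[gcdz h k]gcdz_modr.
have := modz_ge0 k (lt0r_neq0 h_gt0); have := ltz_pmod k h_gt0.
move: (k %% h)%Z => r lt_rh; rewrite le_eqVlt => /orP[/eqP<-|r_gt0].
  have -> : gcdz h 0 = h by rewrite gcdz0; lia.
  by rewrite -scaleD // mulr1 mulr0.
by rewrite rotD // IHN // ?gcdzN 1?gcdzC //; lia.
Qed.

Lemma gcdz_SL2 (g : 'M[int]_2) (h k : int) : inH 1 g ->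
  gcdz (bot g h k) (top g h k) = gcdz h k.
Proof.
move=> hg; have dvd (g' : 'M[int]_2) x y : (gcdz x y %| gcdz (bot g' x y) (top g' x y))%Z.
  by rewrite dvdz_gcd /bot /top !rpredD // dvdz_mull ?dvdz_gcdl ?dvdz_gcdr.
have botK : bot (adj2 g) (bot g h k) (top g h k) = h.
  by rewrite -bot_mul adj2_mul // /bot !mxE /= mul0r mul1r add0r.
have topK : top (adj2 g) (bot g h k) (top g h k) = k.
  by rewrite -top_mul adj2_mul // /top !mxE /= mul0r mul1r addr0.
have := dvd g h k; have := dvd (adj2 g) (bot g h k) (top g h k).
rewrite botK topK /gcdz !dvdzE /= => d1 d2; congr Posz; apply/eqP.
by rewrite eqn_dvd d1.
Qed.

(** Right multiplication by an element of $SL_2(Z)$ permutes the orbits of the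
    left multiplication on $H_m$. *)
Lemma hecke_gcd_rot (V : comNzRingType) w m (h k : int) : (0 < m)%N ->
  let T x y := \sum_(M <- hermite_forms m) (gcdz (bot M x y) (top M x y))%:~R ^+ w : V in
  T k (- h) = T h k.
Proof.
move=> m_gt0 T; pose S := mx2 0 (-1) 1 0.
have hS : inH 1 S by rewrite inH_mx2.
pose S' := mx2 0 1 (-1) 0.
have topS M : top M k (- h) = top (M *m S) h k by rewrite /top !mulmx2E !mx2E; ring.
have botS M : bot M k (- h) = bot (M *m S) h k by rewrite /bot !mulmx2E !mx2E; ring.
have SK (M : 'M[int]_2) : M *m S *m S' = M.
  by apply: mx2_eq; rewrite !mulmx2E !mx2E; ring.
have /choice[f fP] : forall M : 'M[int]_2, exists M', M \in hermite_forms m ->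
    M' \in hermite_forms m /\ exists2 g, inH 1 g & M *m S = g *m M'.
  move=> M; case: (boolP (M \in hermite_forms m)) => hM; last by exists M.
  have hMS : inH m (M *m S).
    by move: (inH_hermite m_gt0 hM) hS; rewrite /inH det_mulmx => /eqP-> /eqP->; rewrite mulr1.
  have [g [M' [hM' hg E]]] := hermite_exists m_gt0 hMS.
  by exists M' => _; split=> //; exists g.
have perm_f : perm_eq (map f (hermite_forms m)) (hermite_forms m).
  have uf : uniq (map f (hermite_forms m)).
    rewrite map_inj_in_uniq ?uniq_hermite_forms // => M M' hM hM' fMM'.
    have [hfM [g hg E]] := fP M hM; have [_ [g' hg' E']] := fP M' hM'.
    have adjE M0 g0 : inH 1 g0 -> M0 *m S = g0 *m f M -> adj2 g0 *m M0 = f M *m S'.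
      by move=> hg0 E0; rewrite -[M0]SK E0 !mulmxA adj2_mul // mul1mx.
    apply: (hermite_unique m_gt0 hM hM' (inH_adj2 hg) (inH_adj2 hg')).
    by rewrite !adjE // fMM'.
  have [] := uniq_min_size uf _ (eq_leq (esym (size_map f _))).
    by move=> _ /mapP[M hM ->]; have [] := fP M hM.
  by move=> _ eqf; apply: uniq_perm; rewrite ?uniq_hermite_forms.
rewrite /T -[RHS](perm_big _ perm_f) big_map; apply: eq_big_seq => M hM.
have [_ [g hg E]] := fP M hM.
by rewrite topS botS E top_mul bot_mul gcdz_SL2.
Qed.

Section HeckePeriod.
Variables (R : realType) (w n : nat).
Hypotheses (w_even : ~~ odd w) (n_int : (0 < n < w)%N).

Lemma beta_Em m : (0 < m)%N -> beta_eq w (Em R w n m) (Sm R w n m).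
Proof.
move=> m_gt0; split=> [|h k h_gt0 k_gt0]; first exact: homogeneous_Sm.
by rewrite eval2_Sm // !EmE // rmorphB.
Qed.

Lemma Em_dedekind_space : dedekind_space w (~~ odd n) (Em R w n 1).
Proof.
have le_nw : (n <= w)%N by have /andP[_ /ltnW] := n_int.
split; last by exists (Sm R w n 1); exact: beta_Em.
  split=> [h k|c h k]; first by move/Em_period->.
  exact: Em_scale.
by move=> h k h_gt0; rewrite Em_parity // -signr_odd.
Qed.

(** Another symbol with the period polynomial of $E_{w,n}$ differs from it by a
    multiple of $gcd(h, k)^w$, whose Hecke transform has period polynomial 0. *)
Lemma hecke_period_Sm m : (0 < m)%N ->
  hecke_period_eq w (~~ odd n) m (Sm R w n 1) (Sm R w n m).
Proof.
move=> m_gt0; have beta1 : beta_eq w (Em R w n 1) (Sm R w n 1) by exact: beta_Em.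
split; first by exists (Em R w n 1); first exact: Em_dedekind_space.
move=> E [[perE scaleE] _ _] [_ betaE]; have [homSm betaEm] := beta_Em m_gt0.
split; first exact: homSm.
move=> h k h_gt0 k_gt0; have le_nw : (n <= w)%N by have /andP[_ /ltnW] := n_int.
pose D h k := E h k - Em R w n 1 h k.
have DE : forall h k, 0 < h -> D h k = (gcdz h k)%:~R ^+ w * D 1 0.
  apply: invariant_symbol_gcd => [x y x0|c x y c0 x0|x y x0 y0].
  - by rewrite /D -(perE _ _ x0) (Em_period _ _ _ _ x0).
  - by rewrite /D (scaleE _ _ _ c0 x0) (Em_scale _ _ le_nw c0 x0) mulrBr.
  - have := betaE x y x0 y0; rewrite -(beta1.2 x y x0 y0) /D => /eqP.
    rewrite subr_eq => /eqP->; set u := Em R w n 1 x y; set u' := Em R w n 1 y _.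
    move: (E y _) u u' => e u u'.
    by rewrite addrAC [u - u' - u]addrAC subrr add0r addrC.
have heckeE x y : 0 < x -> hecke_dedekind m E x y = Em R w n m x y +
    (\sum_(M <- hermite_forms m) (gcdz (bot M x y) (top M x y))%:~R ^+ w) * D 1 0.
  move=> x0; rewrite -hecke_Em // mulr_suml big_hermite_forms -big_split.
  apply: eq_big_seq => d; rewrite -dvdn_divisors // => /(dvdn_gt0 m_gt0) d_gt0.
  rewrite -big_split; apply: eq_bigr => b _ /=.
  rewrite /hermite /bot /top !mx2E mul0r add0r -DE ?mulr_gt0 //.
  by rewrite /D addrC subrK.
rewrite (heckeE _ _ h_gt0) (heckeE _ _ k_gt0) (hecke_gcd_rot _ _ _ _ m_gt0).
by rewrite -(betaEm _ _ h_gt0 k_gt0) opprD addrACA subrr addr0.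
Qed.

End HeckePeriod.

(** * Unordered sums *)

Section HasSum.
Variable K : numFieldType.
Implicit Types (I J : choiceType).

(** Over the complex numbers the hypothesis [0 < e] makes [e] real, so the
    definition needs no separate real and complex versions. *)
Definition has_sum I (x : I -> K) (l : K) : Prop :=
  forall e, 0 < e -> exists A : {fset I}, forall A' : {fset I}, (A `<=` A')%fset ->
    `|l - \sum_(i <- A') x i| < e.

Lemma has_sum_sum I (x : I -> K) l :
  has_sum x l -> summability.sum (x : I -> K^o) = l.
Proof.
move=> xl; have filt := @summability.totally_filter I.
apply: cvg_lim; first exact: norm_hausdorff.
apply/cvgrPdist_lt => e /xl[A hA]; exists A => //= A' AA'.
by have := hA A' AA'; rewrite /summability.partial_sum big_seq_fsetE.
Qed.

Lemma eq_has_sum I (x y : I -> K) l : x =1 y -> has_sum x l -> has_sum y l.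
Proof.
move=> eq_xy xl e /xl[A hA]; exists A => A' /hA.
by rewrite (eq_bigr _ (fun i _ => eq_xy i)).
Qed.

Lemma has_sum0 I : has_sum (fun _ : I => 0) 0.
Proof. by move=> e e0; exists fset0 => A' _; rewrite big1 // subrr normr0. Qed.

Lemma has_sumD I (x y : I -> K) l l' :
  has_sum x l -> has_sum y l' -> has_sum (fun i => x i + y i) (l + l').
Proof.
move=> xl yl e e0; have e2 : 0 < e / 2 by rewrite divr_gt0.
have [A hA] := xl _ e2; have [A' hA'] := yl _ e2.
exists (A `|` A')%fset => D; rewrite fsubUset => /andP[/hA dA /hA' dA'].
rewrite big_split opprD addrACA (le_lt_trans (ler_normD _ _)) //.
by rewrite [e](splitr e) ltrD.
Qed.

Lemma has_sumZ I (c : K) (x : I -> K) l :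
  has_sum x l -> has_sum (fun i => c * x i) (c * l).
Proof.
have [->|c0] := eqVneq c 0.
  by move=> _; rewrite mul0r; apply: eq_has_sum (has_sum0 I) => i; rewrite mul0r.
have nc : 0 < `|c| by rewrite normr_gt0.
move=> xl e e0; have [|A hA] := xl (e / `|c|); first by rewrite divr_gt0.
exists A => A' /hA; rewrite -mulr_sumr -mulrBr normrM.
by rewrite ltr_pdivlMr // mulrC.
Qed.

Lemma has_sum_bigsum I (T : eqType) (r : seq T) (x : T -> I -> K) (l : T -> K) :
  (forall t, t \in r -> has_sum (x t) (l t)) ->
  has_sum (fun i => \sum_(t <- r) x t i) (\sum_(t <- r) l t).
Proof.
elim: r => [|t r IHr] xl.
  by rewrite big_nil; apply: eq_has_sum (has_sum0 I) => i; rewrite big_nil.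
rewrite big_cons; apply: (@eq_has_sum _ (fun i => x t i + \sum_(t <- r) x t i)).
  by move=> i; rewrite big_cons.
apply: has_sumD; first by apply: xl; rewrite mem_head.
by apply: IHr => t' rt'; apply: xl; rewrite inE rt' orbT.
Qed.

(** Along an injection whose image contains the support, finite sums on both
    sides correspond to each other up to zero terms. *)
Lemma has_sum_inj I J (f : I -> J) (x : J -> K) l :
    injective f -> (forall j, x j != 0 -> exists i, f i = j) ->
  has_sum (x \o f) l <-> has_sum x l.
Proof.
move=> f_inj suppf.
have fin (D : {fset J}) : finite_set (f @^-1` [set` D]).
  by apply: finite_preimage => // i j _ _; apply: f_inj.
pose pre (D : {fset J}) := fset_set (f @^-1` [set` D]).
have in_pre D i : (i \in pre D) = (f i \in D).
  by rewrite in_fset_set // mem_setE.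
have sum_im (D : {fset I}) (D' : {fset J}) : ([fset f i | i in D] `<=` D')%fset ->
    (forall j, j \in D' -> x j != 0 -> exists2 i, i \in D & f i = j) ->
    \sum_(i <- D) (x \o f) i = \sum_(j <- D') x j.
  move=> sub supp; rewrite -(big_fset_incl _ sub) => [|j jD' jN].
    by rewrite big_imfset //= => i j _ _; apply: f_inj.
  apply: contraNeq jN => /(supp j jD')[i iD <-].
  by apply/imfsetP; exists i.
split=> xl e /xl[A hA].
  exists [fset f i | i in A]%fset => D sub; rewrite -(sum_im (pre D)).
  - apply: hA; apply/fsubsetP => i iA; rewrite in_pre.
    by apply: (fsubsetP sub); apply/imfsetP; exists i.
  - by apply/fsubsetP => _ /imfsetP[i /= iD ->]; rewrite -in_pre.
  - by move=> j jD /suppf[i fij]; exists i; rewrite // in_pre fij.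
exists (pre A) => D sub; rewrite (sum_im D (A `|` [fset f i | i in D])%fset).
- by apply: hA; exact: fsubsetUl.
- exact: fsubsetUr.
- move=> j; rewrite inE => /orP[jA /suppf[i fij]|/imfsetP[i /= iD ->] _]; last by exists i.
  by exists i => //; apply: (fsubsetP sub); rewrite in_pre fij.
Qed.

End HasSum.

(** The sum is the supremum of the finite partial sums. *)
Lemma has_sum_nonneg (R : realType) (I : choiceType) (x : I -> R) M :
    (forall i, 0 <= x i) -> (forall A : {fset I}, \sum_(i <- A) x i <= M) ->
  exists l, has_sum x l.
Proof.
move=> x0 xM; pose S := [set \sum_(i <- A) x i | A in [set: {fset I}]].
have supS : has_sup S.
  split; first by exists (\sum_(i <- fset0) x i), fset0.
  by exists M => _ [A _ <-].
exists (sup S) => e e0; have [_ [A _ <-] lt_A] := sup_adherent e0 supS.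
exists A => A' AA'; have le_A' : \sum_(i <- A') x i <= sup S.
  by apply: sup_upper_bound => //; exists A'.
have le_AA' : \sum_(i <- A) x i <= \sum_(i <- A') x i.
  rewrite (big_fsetID _ (mem A) A') /= -[leLHS]addr0 lerD ?sumr_ge0 //.
  suff -> : [fset i | i in A' & i \in A]%fset = A by [].
  apply/fsetP => i; rewrite !inE /=.
  by case: (boolP (i \in A)) => [/(fsubsetP AA')->|]; rewrite ?andbF.
by rewrite ger0_norm ?subr_ge0 //; lra.
Qed.

(** Both $|x_i|$ and $|x_i| + x_i$ are nonnegative families. *)
Lemma has_sum_real (R : realType) (I : choiceType) (x : I -> R) M :
    (forall A : {fset I}, \sum_(i <- A) `|x i| <= M) ->
  exists l, has_sum x l.
Proof.
move=> xM; have [l hl] := has_sum_nonneg (fun i => normr_ge0 (x i)) xM.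
have [l' hl'] : exists l', has_sum (fun i => `|x i| + x i) l'.
  apply: (@has_sum_nonneg _ _ _ (M + M)) => [i|A].
    by have := ler_norm (- x i); rewrite normrN; lra.
  rewrite big_split lerD //; apply: le_trans (xM A); apply: ler_sum => i _.
  exact: ler_norm.
exists (l' + -1 * l); have := has_sumD hl' (has_sumZ (-1) hl).
by apply: eq_has_sum => i; ring.
Qed.

Lemma has_sum_complex (R : realType) (I : choiceType) (x : I -> R[i]) (M : R) :
    (forall A : {fset I}, \sum_(i <- A) complex.Re `|x i| <= M) ->
  exists l, has_sum x l.
Proof.
move=> xM.
have toC (y : I -> R) l : has_sum y l -> has_sum (fun i => (y i)%:C%C) (l%:C%C).
  move=> yl [e e'] /[dup] e0; rewrite ltcE /= => /andP[/eqP-> /yl[A hA]].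
  exists A => A' /hA; rewrite -rmorph_sum -rmorphB /=.
  by rewrite -[X in _ -> _ < X]/((e%:C)%C) normc_def /= expr0n addr0 sqrtr_sqr ltcR.
have bound (f : R[i] -> R) : (forall z, `|f z| <= complex.Re `|z|) ->
    exists l, has_sum (fun i => f (x i)) l.
  move=> fz; apply: (@has_sum_real _ _ _ M) => A; apply: le_trans (xM A).
  by apply: ler_sum.
have [|l hl] := bound (@complex.Re R).
  by move=> z; rewrite normc_def /= -sqrtr_sqr ler_wsqrtr // lerDl sqr_ge0.
have [|l' hl'] := bound (@complex.Im R).
  by move=> z; rewrite normc_def /= -sqrtr_sqr ler_wsqrtr // lerDr sqr_ge0.
exists (l%:C%C + 'i%C * l'%:C%C).
have := has_sumD (toC _ _ hl) (has_sumZ 'i%C (toC _ _ hl')).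
by apply: eq_has_sum => i; rewrite -complexE; case: (x i).
Qed.

(** ** Convergence over the modular group *)

Lemma ler_sum_uniq_subset (R : numDomainType) (T : eqType) (s t : seq T) (F : T -> R) :
    uniq s -> uniq t -> {subset s <= t} -> (forall x, 0 <= F x) ->
  \sum_(x <- s) F x <= \sum_(x <- t) F x.
Proof.
move=> us ut st F0; rewrite [leRHS](bigID (mem s)) /=.
have -> : \sum_(x <- t | x \in s) F x = \sum_(x <- s) F x.
  rewrite -big_filter; apply: perm_big; apply: uniq_perm; rewrite ?filter_uniq //.
  by move=> x; rewrite mem_filter andb_idr // => /st.
by rewrite lerDl sumr_ge0.
Qed.

Section LatticeSum.
Variable R : realType.

Definition quad_weight (x : int) : R := (1 + x%:~R ^+ 2)^-1.

Lemma quad_weight_ge0 x : 0 <= quad_weight x.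
Proof. by rewrite invr_ge0 addr_ge0 ?sqr_ge0. Qed.

(** The bound $1 / (1 + N^2) \le 2 / N - 2 / (N + 1)$ telescopes. *)
Lemma sum_quad_weight_nat N : \sum_(i < N.+1) quad_weight i <= 3 - 2 / N.+1%:R.
Proof.
elim: N => [|N IHN].
  by rewrite big_ord1 /quad_weight expr0n addr0 !invr1; lra.
rewrite big_ord_recr /=.
have N1 : 0 < N.+1%:R :> R by rewrite ltr0n.
have N2 : 0 < N.+2%:R :> R by rewrite ltr0n.
have : quad_weight N.+1 <= 2 / N.+1%:R - 2 / N.+2%:R.
  have -> : 2 / N.+1%:R - 2 / N.+2%:R = (N.+1%:R * N.+2%:R / 2)^-1 :> R.
    rewrite -[N.+2]addn1 natrD in N2 *.
    by field; rewrite !lt0r_neq0 //.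
  have q0 : 0 < 1 + N.+1%:Z%:~R ^+ 2 :> R by rewrite addr_gt0 // exprn_gt0.
  rewrite /quad_weight lef_pV2 ?posrE ?divr_gt0 ?mulr_gt0 //.
  rewrite -pmulrn -[N.+2]addn1 natrD; nra.
by move/(lerD IHN)/le_trans; apply; rewrite addrA subrK.
Qed.

Lemma sum_quad_weight (s : seq int) : uniq s -> \sum_(x <- s) quad_weight x <= 6.
Proof.
move=> us; pose N := (\sum_(x <- s) `|x|)%N.
have le_N x : x \in s -> (`|x| <= N)%N.
  by move=> xs; rewrite /N (big_rem x) //= leq_addr.
pose P := [seq i%:Z | i <- iota 0 N.+1].
have sumP : \sum_(x <- P) quad_weight x <= 3.
  rewrite big_map -[iota _ _]/(index_iota 0 N.+1) big_mkord.
  apply: (le_trans (sum_quad_weight_nat N)); rewrite gerBl divr_ge0 //.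
have uP : uniq P by rewrite map_inj_uniq ?iota_uniq // => i j [].
have bound (t : seq int) : uniq t -> {subset t <= P} -> \sum_(x <- t) quad_weight x <= 3.
  by move=> ut tP; apply: le_trans sumP; apply: ler_sum_uniq_subset => // x; apply: quad_weight_ge0.
have -> : 6 = 3 + 3 :> R by ring.
rewrite (bigID (fun x => 0 <= x)) /=; apply: lerD; rewrite -big_filter.
  apply: bound; first exact: filter_uniq.
  move=> x; rewrite mem_filter => /andP[x0 /le_N xN].
  by apply/mapP; exists `|x|%N; rewrite ?mem_iota //; lia.
(* The weight is even, so the negative numbers are reflected. *)
pose neg := [seq - x | x <- [seq x <- s | ~~ (0 <= x)]].
have -> : \sum_(x <- [seq x <- s | ~~ (0 <= x)]) quad_weight x =
    \sum_(x <- neg) quad_weight x.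
  by rewrite big_map; apply: eq_bigr => x _; rewrite /quad_weight rmorphN sqrrN.
apply: bound; first by rewrite map_inj_uniq ?filter_uniq //; apply: oppr_inj.
move=> _ /mapP[x + ->]; rewrite mem_filter => /andP[x0 /le_N xN].
by apply/mapP; exists `|x|%N; rewrite ?mem_iota //; lia.
Qed.

(** An injection into $Z^3$ compares the sum with a product of three sums. *)
Lemma sum_quad_weight3 (T : eqType) (s : seq T) (f1 f2 f3 : T -> int) :
    uniq s -> {in s &, injective (fun x => (f1 x, f2 x, f3 x))} ->
  \sum_(x <- s) quad_weight (f1 x) * quad_weight (f2 x) * quad_weight (f3 x) <= 216.
Proof.
move=> us inj_f; pose f x := (f1 x, f2 x, f3 x).
pose r := undup (map f1 s ++ map f2 s ++ map f3 s).
pose G (p : int * int * int) := quad_weight p.1.1 * quad_weight p.1.2 * quad_weight p.2.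
have G0 p : 0 <= G p by rewrite !mulr_ge0 ?quad_weight_ge0.
have ur : uniq r by apply: undup_uniq.
pose box := [seq (x, y) | x <- [seq (x, y) | x <- r, y <- r], y <- r].
have -> : \sum_(x <- s) quad_weight (f1 x) * quad_weight (f2 x) * quad_weight (f3 x) =
    \sum_(p <- map f s) G p by rewrite big_map.
apply: (@le_trans _ _ (\sum_(p <- box) G p)).
  apply: ler_sum_uniq_subset => //; first by rewrite map_inj_in_uniq.
    by rewrite !allpairs_uniq // => -[? ?] [? ?].
  move=> _ /mapP[x xs ->]; rewrite /f !allpairs_f ?mem_undup ?mem_cat ?map_f ?orbT //.
have -> : \sum_(p <- box) G p = (\sum_(x <- r) quad_weight x) ^+ 3.
  rewrite big_allpairs_dep big_allpairs_dep /= /G /= 2!exprS expr1 mulr_suml.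
  apply: eq_bigr => x _; rewrite mulr_suml mulr_sumr; apply: eq_bigr => y _.
  by rewrite -mulr_sumr mulrA.
have -> : 216 = 6 ^+ 3 :> R by rewrite -natrX.
by rewrite lerXn2r ?nnegrE ?sumr_ge0 ?sum_quad_weight // => x _; apply: quad_weight_ge0.
Qed.

Definition row_norm (A : 'M[int]_2) i : int := A i 0 ^+ 2 + A i 1 ^+ 2.

Lemma mulD1_le (x y : int) : 0 <= x -> 0 <= y -> 0 < x + y ->
  (1 + x) * (1 + y) <= 4 * (x + y) ^+ 2.
Proof.
move=> x0 y0 xy0.
have xy : x * y <= (x + y) ^+ 2 by rewrite expr2; nia.
have s1 : x + y <= (x + y) ^+ 2 by rewrite expr2 ler_peMl; lia.
have -> : (1 + x) * (1 + y) = 1 + (x + y) + x * y by ring.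
by lia.
Qed.

(** From $U V = (a c + b d)^2 + 1$ and $U \le V$ one gets bounds of $U^2$ and
    $(t U)^2$ by multiples of $U V$. *)
Lemma SL2_rows_bound (a b c d : int) :
    a * d - b * c = 1 -> a ^+ 2 + b ^+ 2 <= c ^+ 2 + d ^+ 2 ->
  let U := a ^+ 2 + b ^+ 2 in let V := c ^+ 2 + d ^+ 2 in
  let t := ((a * c + b * d) %/ U)%Z in
  [/\ 0 < U, 0 < V &
      (1 + a ^+ 2) * (1 + b ^+ 2) * (1 + t ^+ 2) <= 20 * (U * V)].
Proof.
move=> dA le_UV U V t; set Q := a * c + b * d in t *.
have U0 : 0 < U.
  rewrite lt0r addr_ge0 ?sqr_ge0 // andbT paddr_eq0 ?sqr_ge0 // !expf_eq0 /=.
  by apply/negP => /andP[/eqP a0 /eqP b0]; move: dA; rewrite a0 b0 !mul0r subr0.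
have UV : U * V = Q ^+ 2 + 1.
  have -> : U * V = Q ^+ 2 + (a * d - b * c) ^+ 2 by rewrite /U /V /Q; ring.
  by rewrite dA expr1n.
have V0 : 0 < V by exact: lt_le_trans le_UV.
split=> //; rewrite {}/t.
have h1 : (1 + a ^+ 2) * (1 + b ^+ 2) <= 4 * U ^+ 2 by rewrite mulD1_le ?sqr_ge0.
have UU : U ^+ 2 <= U * V by rewrite expr2 ler_wpM2l // ltW.
have := divz_eq Q U; have := modz_ge0 Q (lt0r_neq0 U0); have := ltz_pmod Q U0.
move: (Q %/ U)%Z (Q %% U)%Z => p r rU r0 QE.
clearbody Q; clear dA le_UV.
have pU : (p * U) ^+ 2 <= 2 * Q ^+ 2 + 2 * U ^+ 2.
  have -> : p * U = Q - r by rewrite QE; ring.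
  have rU2 : r ^+ 2 <= U ^+ 2 by rewrite lerXn2r ?nnegrE // ltW.
  have := sqr_ge0 (Q + r).
  have -> : (Q + r) ^+ 2 = Q ^+ 2 + r ^+ 2 + 2 * (Q * r) by ring.
  have -> : (Q - r) ^+ 2 = Q ^+ 2 + r ^+ 2 - 2 * (Q * r) by ring.
  by move: (Q ^+ 2) (r ^+ 2) (U ^+ 2) (Q * r) rU2 => q r2 u qr; lia.
have h2 : (1 + p ^+ 2) * U ^+ 2 <= 5 * (U * V).
  have -> : (1 + p ^+ 2) * U ^+ 2 = U ^+ 2 + (p * U) ^+ 2 by ring.
  by move: (U * V) (U ^+ 2) ((p * U) ^+ 2) (Q ^+ 2) UV UU pU => uv u pu q; lia.
apply: (@le_trans _ _ (4 * U ^+ 2 * (1 + p ^+ 2))).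
  by rewrite ler_wpM2r // addr_ge0 // sqr_ge0.
have -> : 4 * U ^+ 2 * (1 + p ^+ 2) = 4 * ((1 + p ^+ 2) * U ^+ 2) by ring.
have -> : 20 * (U * V) = 4 * (5 * (U * V)) by ring.
by rewrite ler_pM2l.
Qed.

(** Given the top row $u$ of a matrix in $SL_2(Z)$, its bottom row $v$ is
    determined up to multiples of $u$, hence by the integer part $t$ of
    $u.v / |u|^2$. As $|u|^2 |v|^2 = (u.v)^2 + 1$, in the case
    $|u| \le |v|$ this product dominates $|u|^4 (1 + t^2)$. *)
Lemma sum_SL2_le (s : seq 'M[int]_2) : uniq s ->
    (forall A, A \in s -> inH 1 A /\ row_norm A 0 <= row_norm A 1) ->
  \sum_(A <- s) ((row_norm A 0)%:~R * (row_norm A 1)%:~R)^-1 <= 20 * 216 :> R.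
Proof.
move=> us hs.
pose q (A : 'M[int]_2) := A 0 0 * A 1 0 + A 0 1 * A 1 1.
pose t A := (q A %/ row_norm A 0%R)%Z.
have inj_t : {in s &, injective (fun A : 'M[int]_2 => (A 0 0, A 0 1, t A))}.
  move=> A A' /hs[hA _] /hs[hA' _] [e00 e01]; rewrite /t /q /row_norm -e00 -e01.
  move: hA hA'; rewrite !inHE -e00 -e01 => /eqP dA /eqP dA'.
  move=> et; have [ec ed] : A 1 0 = A' 1 0 /\ A 1 1 = A' 1 1; last exact: mx2_eq.
  move: (A 0 0) (A 0 1) (A 1 0) (A 1 1) (A' 1 0) (A' 1 1) dA dA' et {e00 e01}.
  move=> a b c d c' d' dA dA'; pose k := c' * d - c * d'.
  have ad : a * d = b * c + 1 by rewrite -[1]dA; ring.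
  have ad' : a * d' = b * c' + 1 by rewrite -[1]dA'; ring.
  have cE : c' = c + k * a.
    have -> : k * a = c' * (a * d) - c * (a * d') by rewrite /k; ring.
    by rewrite ad ad'; ring.
  have dE : d' = d + k * b.
    have -> : k * b = d * (b * c' + 1) - d' * (b * c + 1) + (d' - d).
      by rewrite /k; ring.
    by rewrite -ad -ad'; ring.
  have u0 : a ^+ 2 + b ^+ 2 != 0 by nia.
  have -> : a * c' + b * d' = k * (a ^+ 2 + b ^+ 2) + (a * c + b * d).
    by rewrite {1}cE {1}dE; ring.
  rewrite divzMDl // => ek; have k0 : k = 0 by lia.
  by rewrite cE dE k0 !mul0r !addr0.
apply: (@le_trans _ _ (\sum_(A <- s) 20 *
    (quad_weight (A 0 0) * quad_weight (A 0 1) * quad_weight (t A)))); last first.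
  by rewrite -mulr_sumr ler_wpM2l // sum_quad_weight3.
rewrite big_seq [leRHS]big_seq; apply: ler_sum => A /hs[].
rewrite inHE /quad_weight /t /q /row_norm => /eqP.
move: (A 0 0) (A 0 1) (A 1 0) (A 1 1) => a b c d dA le_UV.
set U := a ^+ 2 + b ^+ 2; set V := c ^+ 2 + d ^+ 2; set Q := a * c + b * d.
have [U0 V0 key] := SL2_rows_bound dA le_UV.
have wpos (x : int) : 0 < 1 + x%:~R ^+ 2 :> R by rewrite ltr_wpDr // sqr_ge0.
rewrite -!invfM -[20]invrK -invfM lef_pV2 ?posrE; first last.
- by rewrite !mulr_gt0 ?invr_gt0.
- by rewrite mulr_gt0 ?ltr0z.
rewrite ler_pdivrMl //; move: key; rewrite -(ler_int R).
by rewrite !intrM !intrD !rmorphXn.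
Qed.

Lemma row_norm_gt0 A i : inH 1 A -> 0 < row_norm A i.
Proof.
rewrite inHE => /eqP dA; rewrite lt0r addr_ge0 ?sqr_ge0 // andbT.
rewrite paddr_eq0 ?sqr_ge0 // !expf_eq0 /=; apply/negP => /andP[/eqP r0 /eqP r1].
have [i0|i1] : i = 0 \/ i = 1.
  by case: i {r0 r1} => [[|[|//]]] hi; [left | right]; apply: val_inj.
  by move: r0 r1 dA; rewrite i0 => -> ->; rewrite !mul0r subr0.
by move: r0 r1 dA; rewrite i1 => -> ->; rewrite !mulr0 subr0.
Qed.

(** The exchange of the rows reduces the matrices whose first row is the
    longer one to the others. *)
Lemma sum_SL2 (s : seq 'M[int]_2) : uniq s -> (forall A, A \in s -> inH 1 A) ->
  \sum_(A <- s) ((row_norm A 0)%:~R * (row_norm A 1)%:~R)^-1 <= 2 * (20 * 216) :> R.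
Proof.
move=> us hs; have -> : 2 * (20 * 216) = 20 * 216 + 20 * 216 :> R by ring.
rewrite (bigID (fun A => row_norm A 0 <= row_norm A 1)) /=.
apply: lerD; rewrite -big_filter.
  apply: sum_SL2_le; first exact: filter_uniq.
  by move=> A; rewrite mem_filter => /andP[le_A /hs hA].
pose swap (A : 'M[int]_2) := mx2 (A 1 0) (A 1 1) (- A 0 0) (- A 0 1).
have swap0 A : row_norm (swap A) 0 = row_norm A 1 by rewrite /row_norm !mx2E.
have swap1 A : row_norm (swap A) 1 = row_norm A 0 by rewrite /row_norm !mx2E !sqrrN.
have swap_inj : injective swap.
  move=> A A' e; have E i j : swap A i j = swap A' i j by rewrite e.
  have := (E 0 0, E 0 1, E 1 0, E 1 1); rewrite !mx2E => -[[[e1 e2] e3] e4].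
  by apply: mx2_eq => //; apply: oppr_inj.
set s' := [seq A <- s | _].
have -> : \sum_(A <- s') ((row_norm A 0)%:~R * (row_norm A 1)%:~R)^-1 =
    \sum_(A <- map swap s') ((row_norm A 0)%:~R * (row_norm A 1)%:~R)^-1 :> R.
  by rewrite big_map; apply: eq_bigr => A _; rewrite swap0 swap1 mulrC.
apply: sum_SL2_le; first by rewrite map_inj_uniq ?filter_uniq.
move=> _ /mapP[A + ->]; rewrite mem_filter swap0 swap1 -ltNge => /andP[/ltW le_A /hs].
rewrite !inHE !mx2E => /eqP dA; split=> //; apply/eqP; rewrite -[RHS]dA; ring.
Qed.

End LatticeSum.

(** ** The cusp forms *)

Section CuspForms.
Variable R : realType.
Local Notation C := R[i].

Definition Rm_term (w n : nat) (z : C) (A : 'M[int]_2) : C :=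
  1 / (((A 0 0)%:~R * z + (A 0 1)%:~R) ^+ n.+1
       * ((A 1 0)%:~R * z + (A 1 1)%:~R) ^+ (w - n).+1).

Lemma norm_linear_form (z : C) (a b : int) :
  complex.Re `|a%:~R * z + b%:~R| ^+ 2 =
  (a%:~R * complex.Re z + b%:~R) ^+ 2 + (a%:~R * complex.Im z) ^+ 2.
Proof.
have -> : a%:~R * z + b%:~R =
    ((a%:~R * complex.Re z + b%:~R) +i* (a%:~R * complex.Im z))%C.
  rewrite -!(rmorph_int (real_complex R)); case: z => x y /=.
  by rewrite /=; simpc.
by rewrite normc_def /= sqr_sqrtr // addr_ge0 ?sqr_ge0.
Qed.

(** The square of $|a z + b|$ is a positive definite quadratic form in $(a,
    b)$. *)
Lemma linear_form_lower_bound (z : C) : 0 < complex.Im z ->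
  exists2 e : R, 0 < e & forall a b : int,
    e ^+ 2 * (a ^+ 2 + b ^+ 2)%:~R <= complex.Re `|a%:~R * z + b%:~R| ^+ 2.
Proof.
move=> y_gt0; set y := complex.Im z; set x := complex.Re z.
pose K := (y^-1) ^+ 2 + 2 + 2 * (x / y) ^+ 2.
have K1 : 1 <= K.
  by rewrite /K; have := sqr_ge0 (y^-1); have := sqr_ge0 (x / y); lra.
have K0 : 0 < K by lra.
exists K^-1 => [|a b]; first by rewrite invr_gt0.
rewrite norm_linear_form -/x -/y.
have : (a ^+ 2 + b ^+ 2)%:~R <=
    K * ((a%:~R * x + b%:~R) ^+ 2 + (a%:~R * y) ^+ 2) :> R.
  rewrite rmorphD !rmorphXn /=.
  move: (a%:~R : R) (b%:~R : R) => {}a {}b; set q := a * y; set p := a * x + b.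
  (* p and q are the real and imaginary parts of a z + b. *)
  have -> : a = q / y by rewrite /q mulfK // gt_eqF.
  have -> : b = p - q * (x / y) by rewrite /p /q mulrACA mulrC; field; rewrite gt_eqF.
  rewrite /K exprMn; clearbody p q; move: (y^-1) => i; set t := x * i.
  rewrite -subr_ge0.
  have -> : (i ^+ 2 + 2 + 2 * t ^+ 2) * (p ^+ 2 + q ^+ 2) - (q ^+ 2 * i ^+ 2 + (p - q * t) ^+ 2)
      = (i * p) ^+ 2 + 2 * q ^+ 2 + 2 * (t * p) ^+ 2 + (p + q * t) ^+ 2 by ring.
  have := sqr_ge0 (i * p); have := sqr_ge0 q; have := sqr_ge0 (t * p).
  by have := sqr_ge0 (p + q * t); lra.
rewrite [K^-1 ^+ 2]expr2 -mulrA => le_K.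
rewrite ler_pdivrMl // ler_pdivrMl //.
apply: (le_trans le_K); rewrite ler_pM2l //.
by rewrite -[leLHS]mul1r ler_wpM2r // addr_ge0 ?sqr_ge0.
Qed.

(** Both exponents are at least 2 and the rows of the matrix are not 0, so the
    terms are dominated by the inverse products of the squared lengths of the
    rows. *)
Lemma summable_Rm_term w n z : (0 < n < w)%N -> 0 < complex.Im z ->
  exists l, has_sum (fun g : {A : 'M[int]_2 | inH 1 A} => Rm_term w n z (val g)) l.
Proof.
move=> /andP[n_gt0 n_lt_w] /linear_form_lower_bound[e e0 he].
pose q (a b : int) := complex.Re `|a%:~R * z + b%:~R|.
have normE a b : `|a%:~R * z + b%:~R| = (q a b)%:C%C by rewrite /q normc_def.
have q0 a b : 0 <= q a b by rewrite /q normc_def sqrtr_ge0.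
have le_eq a b : 0 < a ^+ 2 + b ^+ 2 -> e <= q a b.
  move=> ab0; rewrite -(@ler_pXn2r _ 2) ?nnegrE ?q0 ?(ltW e0) //.
  apply: le_trans (he a b); rewrite -[leLHS]mulr1 ler_wpM2l ?sqr_ge0 //.
  by rewrite -[1]/(1%:~R) ler_int.
have power a b j : 0 < a ^+ 2 + b ^+ 2 ->
    (0 < j)%N -> e ^+ j.+1 * (a ^+ 2 + b ^+ 2)%:~R <= q a b ^+ j.+1.
  case: j => // j ab0 _; rewrite -addn2 !exprD -mulrA.
  apply: ler_pM (he a b); first by rewrite exprn_ge0 ?(ltW e0).
    by rewrite mulr_ge0 ?sqr_ge0 // ler0z ltW.
  by rewrite lerXn2r ?nnegrE ?q0 ?(ltW e0) // le_eq.
pose c := (e ^+ n.+1 * e ^+ (w - n).+1)^-1.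
apply: (@has_sum_complex _ _ _ (c * (2 * (20 * 216)))) => A.
apply: (@le_trans _ _ (\sum_(g <- A) c *
    ((row_norm (val g) 0)%:~R * (row_norm (val g) 1)%:~R)^-1)).
  apply: ler_sum => g _; have hg := valP g.
  have row_gt0 i : 0 < row_norm (val g) i by apply: row_norm_gt0.
  rewrite /Rm_term div1r normfV normrM !normrX !normE -!rmorphXn -rmorphM -fmorphV /=.
  rewrite /c -invfM lef_pV2 ?posrE.
  - rewrite mulrACA; apply: ler_pM.
    + by rewrite mulr_ge0 ?exprn_ge0 ?(ltW e0) // ler0z ltW.
    + by rewrite mulr_ge0 ?exprn_ge0 ?(ltW e0) // ler0z ltW.
    + by apply: power => //; apply: row_gt0.
    + by apply: power; rewrite ?subn_gt0 //; apply: row_gt0.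
  - by rewrite mulr_gt0 // exprn_gt0 // (lt_le_trans e0) // le_eq //; apply: row_gt0.
  - by rewrite !mulr_gt0 ?exprn_gt0 ?ltr0z.
rewrite -mulr_sumr ler_wpM2l ?invr_ge0 ?mulr_ge0 ?exprn_ge0 ?(ltW e0) //.
rewrite -(big_map val xpredT (fun A' => ((row_norm A' 0)%:~R * (row_norm A' 1)%:~R)^-1)).
apply: sum_SL2; first by rewrite map_inj_uniq ?fset_uniq //; apply: val_inj.
by move=> _ /mapP[g _ ->]; apply: valP.
Qed.

Lemma Rm_term_mul w n (z : C) (M g : 'M[int]_2) (a b d : int) :
    (n <= w)%N -> d != 0 -> M = mx2 a b 0 d ->
  Rm_term w n z (g *m M) =
  d%:~R ^- (w + 2) * Rm_term w n ((a%:~R * z + b%:~R) / d%:~R) g.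
Proof.
move=> le_nw; rewrite -(intr_eq0 C) => d0 ->; rewrite /Rm_term !mulmx2E !mx2E.
rewrite !mulr0 !addr0 !(rmorphM, rmorphD) /=.
set z' := (a%:~R * z + b%:~R) / d%:~R.
have E (x y : C) : x * a%:~R * z + (x * b%:~R + y * d%:~R) = d%:~R * (x * z' + y).
  by rewrite /z'; field.
rewrite !E !exprMn mulrACA -exprD !div1r invfM; congr (_^-1 * _); congr (_ ^+ _).
by lia.
Qed.

Definition SL2_orbit (M : 'M[int]_2) : set 'M[int]_2 := [set A | exists2 g, inH 1 g & A = g *m M].

(** The orbits of the left action of $SL_2(Z)$ on $H_m$, one for each Hermite
    normal form, split the sum over $H_m$. *)
Lemma hecke_Rm w n m (z : C) : (0 < m)%N -> (0 < n < w)%N -> 0 < complex.Im z ->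
  hecke_form w m (@Rm R w n 1) z = Rm w n m z.
Proof.
move=> m_gt0 n_int z_gt0; have /andP[n_gt0 n_lt_w] := n_int.
pose z' (M : 'M[int]_2) : C := ((M 0 0)%:~R * z + (M 0 1)%:~R) / (M 1 1)%:~R.
have hM M : M \in hermite_forms m -> exists a b d : int,
    [/\ M = mx2 a b 0 d, 0 < a & 0 < d].
  move=> /(mem_hermite_forms _ m_gt0)[a [b [d [-> adm _]]]].
  by exists a, b, d; split; rewrite ?ltz_nat //; lia.
have z'_gt0 M : M \in hermite_forms m -> 0 < complex.Im (z' M).
  move=> /hM[a [b [d [-> a0 d0]]]]; rewrite /z' !mx2E.
  have -> : (a%:~R * z + b%:~R) / d%:~R =
      (a%:~R / d%:~R : R)%:C%C * z + (b%:~R / d%:~R : R)%:C%C.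
    by rewrite !rmorphM !fmorphV !rmorph_int mulrDl mulrAC.
  have ad0 : 0 < a%:~R / d%:~R :> R by rewrite divr_gt0 ?ltr0z.
  move: (_ / _ : R) (_ / _ : R) ad0 => p q p0; clear -z_gt0 p0; case: z z_gt0 => u v /= v0.
  by simpc; rewrite mulr_gt0.
have /choice[l hl] : forall M : 'M[int]_2, exists l, M \in hermite_forms m ->
    has_sum (fun g : {A : 'M[int]_2 | inH 1 A} => Rm_term w n (z' M) (val g)) l.
  move=> M; case: (boolP (M \in hermite_forms m)) => hMm; last by exists 0.
  by have [l hl] := summable_Rm_term n_int (z'_gt0 M hMm); exists l.
pose y (M A : 'M[int]_2) : C := if `[< SL2_orbit M A >] then Rm_term w n z A else 0.
have sum_y M : M \in hermite_forms m -> has_sum (y M) ((M 1 1)%:~R ^- (w + 2) * l M).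
  move=> hMm; have [a [b [d [ME a0 d0]]]] := hM M hMm.
  pose f (g : {A : 'M[int]_2 | inH 1 A}) := val g *m M.
  apply/(@has_sum_inj _ _ _ f).
  - by move=> g g' /(hermite_mulI m_gt0 hMm)/val_inj.
  - move=> A; rewrite /y; case: asboolP => [[g hg ->] _|]; last by rewrite eqxx.
    by exists (exist _ g hg).
  apply: eq_has_sum (has_sumZ _ (hl M hMm)) => g; rewrite /y /=.
  case: asboolP => [_|[]]; last by exists (val g) => //; apply: valP.
  rewrite (Rm_term_mul z (val g) (ltnW n_lt_w) (lt0r_neq0 d0) ME).
  by rewrite /z' ME !mx2E.
have sum_Hm : has_sum (fun A : {A : 'M[int]_2 | inH m A} => Rm_term w n z (val A))
    (\sum_(M <- hermite_forms m) (M 1 1)%:~R ^- (w + 2) * l M).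
  have supp A : \sum_(M <- hermite_forms m) y M A != 0 ->
      exists A' : {A : 'M[int]_2 | inH m A}, val A' = A.
    move=> nz; suff hA : inH m A by exists (exist _ A hA).
    apply: contraNT nz => hA; rewrite big_seq big1 // => M hMm; rewrite /y.
    case: asboolP => // -[g hg AE]; move: hA.
    by rewrite AE (inH_mul hg (inH_hermite m_gt0 hMm)).
  apply: eq_has_sum ((has_sum_inj _ val_inj supp).2 (has_sum_bigsum sum_y)) => A' /=.
  have [g [M0 [hM0 hg AE]]] := hermite_exists m_gt0 (valP A').
  rewrite (bigD1_seq M0) ?uniq_hermite_forms //= big_seq_cond big1 => [|M].
    by rewrite addr0 /y asboolT //; exists g.
  move=> /andP[hMm neqM]; rewrite /y; case: asboolP => // -[g' hg' AE'].
  case/negP: neqM; apply/eqP; apply: (hermite_unique m_gt0 hMm hM0 hg' hg).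
  by rewrite -AE' -AE.
rewrite /hecke_form [RHS]/Rm (has_sum_sum sum_Hm) big_hermite_forms -mulrA.
congr (_ * _); rewrite mulr_sumr; apply: eq_big_seq => d dm.
rewrite mulr_sumr; apply: eq_bigr => b _.
have hMm : hermite m d b \in hermite_forms m.
  by apply/allpairsPdep; exists d, (val b); rewrite mem_iota /= ltn_ord.
have zE : ((m %/ d)%N%:R * z + b%:R) / d%:R = z' (hermite m d b).
  by rewrite /z' !mx2E.
rewrite zE /Rm (has_sum_sum (hl _ hMm)) expr1n mul1r mx2E mulrCA.
by [].
Qed.

End CuspForms.

(** * The action of the Hecke operators *)

Theorem theorem2p8 (R : realType) (w m n : nat)
    (w_gt0 : (0 < w)%N) (w_even : ~~ odd w) (m_gt0 : (0 < m)%N)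
    (n_gt0 : (0 < n)%N) (n_lt_w : (n < w)%N) :
  [/\ forall z : R[i], 0 < complex.Im z ->
        hecke_form w m (@Rm R w n 1) z = Rm w n m z,
      forall h k : int, 0 < h ->
        hecke_dedekind m (@Em R w n 1) h k = Em R w n m h k
    & hecke_period_eq w (~~ odd n) m (Sm R w n 1) (Sm R w n m)].
Proof.
have n_int : (0 < n < w)%N by rewrite n_gt0.
split=> [z|h k|]; first exact: hecke_Rm.
  exact: hecke_Em.
exact: hecke_period_Sm.
Qed.
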